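(* Let $\mathbb{F}$ be any field. The graph isomorphism problem Karp-reduces (in polynomial time) to the code equivalence problem over $\mathbb{F}$.
   Context: A code of length $n$ over $\mathbb{F}$ is a linear subspace of $\mathbb{F}^n$, given by a basis. The symmetric group $S_n$ acts on $\mathbb{F}^n$ by $\pi\cdot(\alpha_1,\dots,\alpha_n)=(\alpha_{\pi(1)},\dots,\alpha_{\pi(n)})$, and on subspaces by $\pi\cdot V=\{\pi\cdot v: v\in V\}$. Code equivalence problem: given two codes $C_1,C_2\subseteq\mathbb{F}^n$, determine whether there is $\pi\in S_n$ with $\pi\cdot C_1=C_2$. Graph isomorphism: given two finite graphs, decide whether they are isomorphic. *)

(* Defs.v *)
From HB Require Import structures.
From mathcomp Require Import all_boot all_order all_fingroup all_algebra.
Set Implicit Arguments.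
Unset Strict Implicit.
Unset Printing Implicit Defensive.
Import GRing.Theory.
Local Open Scope ring_scope.

(** * Deterministic multitape Turing machines *)

Inductive direction := GoLeft | GoRight | Stay.

Section Turing.
Variable S : finType.

(* The tape alphabet is S plus auxiliary symbols W plus the blank [None]. *)
Definition cell (W : finType) : finType := option (S + W)%type.

(* A bi-infinite tape: the cells left of the head (nearest first), the scanned
   cell, and the cells right of the head; all unlisted cells are blank. *)
Record tape (W : finType) :=
  Tape { lcells : seq (cell W); scanned : cell W; rcells : seq (cell W) }.

Definition move (W : finType) (d : direction) (t : tape W) : tape W :=
  match d with
  | GoLeft =>
      Tape (behead (lcells t)) (head None (lcells t)) (scanned t :: rcells t)
  | GoRight =>
      Tape (scanned t :: lcells t) (head None (rcells t)) (behead (rcells t))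
  | Stay => t
  end.

Definition write (W : finType) (c : cell W) (t : tape W) : tape W :=
  Tape (lcells t) c (rcells t).

(* There are ntapes.+1 tapes; tape [ord0] holds the input, tape [ord_max] the
   output.  The machine halts when [delta] returns [None]. *)
Record tm := TM {
  ntapes : nat;
  wsym : finType;
  state : finType;
  start : state;
  delta : state -> {ffun 'I_ntapes.+1 -> cell wsym} ->
          option (state * {ffun 'I_ntapes.+1 -> cell wsym * direction})
}.

Definition tapes (M : tm) := {ffun 'I_(ntapes M).+1 -> tape (wsym M)}.
Definition config (M : tm) := (state M * tapes M)%type.

Definition scan (M : tm) (ts : tapes M) : {ffun 'I_(ntapes M).+1 -> cell (wsym M)} :=
  [ffun i => scanned (ts i)].

Definition step (M : tm) (c : config M) : option (config M) :=
  match delta c.1 (scan c.2) with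
  | None => None
  | Some (q, a) => Some (q, [ffun i => move (a i).2 (write (a i).1 (c.2 i))])
  end.

Fixpoint steps (M : tm) (t : nat) (c : config M) : option (config M) :=
  if t is t'.+1 then obind (steps t') (step c) else Some c.

Definition letter (W : finType) (a : S) : cell W := Some (inl a).

Definition word_tape (W : finType) (w : seq S) : tape W :=
  let s := map (@letter W) w in Tape [::] (head None s) (behead s).

Definition init (M : tm) (w : seq S) : config M :=
  (start M, [ffun i => word_tape (wsym M) (if i == ord0 then w else [::])]).

(* The head stands on the first letter of u, and only blanks follow u. *)
Definition tape_reads (W : finType) (t : tape W) (u : seq S) : Prop :=
  exists m : nat, scanned t :: rcells t = map (@letter W) u ++ nseq m None.

Definition halts_with (M : tm) (w : seq S) (t : nat) (u : seq S) : Prop :=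
  exists c : config M, [/\ steps t (init M w) = Some c, step c = None &
                           tape_reads (c.2 ord_max) u].

Definition polytime (f : seq S -> seq S) : Prop :=
  exists (M : tm) (a d : nat), forall w : seq S,
    exists2 t : nat, (t <= a * size w ^ d + a)%N & halts_with M w t (f w).

Definition language := seq S -> Prop.

Definition karp_reduces (A B : language) : Prop :=
  exists2 f : seq S -> seq S, polytime f & forall w : seq S, A w <-> B (f w).

End Turing.

(** * Instances as words *)

(* [Some b] is the bit b, [None] is a separator. *)
Definition sym : finType := option bool.

Definition enc_nat (n : nat) : seq sym := rcons (nseq n (Some true)) None.

Definition enc_bits (w : seq bool) : seq sym := rcons (map Some w) None.

(** * Graph isomorphism *)

Definition simple_graph (n : nat) (e : rel 'I_n) : Prop :=
  symmetric e /\ irreflexive e.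

Definition graph_iso (n1 n2 : nat) (e1 : rel 'I_n1) (e2 : rel 'I_n2) : Prop :=
  exists2 f : 'I_n1 -> 'I_n2, bijective f &
    forall x y : 'I_n1, e2 (f x) (f y) = e1 x y.

(* The number of vertices, then the adjacency matrix, row by row. *)
Definition enc_graph (n : nat) (e : rel 'I_n) : seq sym :=
  enc_nat n ++ [seq Some (e i j) | i <- enum 'I_n, j <- enum 'I_n].

Definition GraphIso : language sym := fun w =>
  exists (n1 n2 : nat) (e1 : rel 'I_n1) (e2 : rel 'I_n2),
    [/\ simple_graph e1, simple_graph e2, w = enc_graph e1 ++ enc_graph e2
      & graph_iso e1 e2].

(** * Code equivalence *)

Section Codes.
Variable F : fieldType.

(* [col_perm s v] has j-th coordinate [v 0 (s j)]. *)
Definition perm_code (n : nat) (s : 'S_n) (C : {vspace 'rV[F]_n}) :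
    {vspace 'rV[F]_n} :=
  (linfun (col_perm s : 'rV[F]_n -> 'rV[F]_n) @: C)%VS.

Definition code_equiv (n : nat) (C1 C2 : {vspace 'rV[F]_n}) : Prop :=
  exists s : 'S_n, perm_code s C1 = C2.

(* Field elements are written as bit strings; [rep w] is the element written w,
   if any.  An element may have several names, or none, as is unavoidable when
   F is uncountable. *)
Variable rep : seq bool -> option F.

Definition encodes_basis (n k : nat) (B : k.-tuple 'rV[F]_n) (u : seq sym) : Prop :=
  exists2 W : 'I_k -> 'I_n -> seq bool,
    forall i j, rep (W i j) = Some (tnth B i 0 j) &
    u = enc_nat k ++
        flatten [seq enc_bits (W i j) | i <- enum 'I_k, j <- enum 'I_n].

Definition CodeEquiv : language sym := fun w =>
  exists (n k1 k2 : nat) (C1 C2 : {vspace 'rV[F]_n})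
         (B1 : k1.-tuple 'rV[F]_n) (B2 : k2.-tuple 'rV[F]_n) (u1 u2 : seq sym),
    [/\ basis_of C1 B1 /\ encodes_basis B1 u1,
        basis_of C2 B2 /\ encodes_basis B2 u2,
        w = enc_nat n ++ u1 ++ u2
      & code_equiv C1 C2].

End Codes.

(* Main.v *)
Require Import Defs.
From mathcomp Require Import all_boot all_order all_fingroup all_algebra.
From mathcomp Require Import zify.
Import GRing.Theory.
Set Implicit Arguments.
Unset Strict Implicit.
Unset Printing Implicit Defensive.

(* A graph e on n vertices is sent to the code generated by the rows of
   [I | I | I | I | diag e | D], indexed by the ordered pairs of vertices, where
   D marks the members of each pair.  The four identity blocks give weight at
   least 8 to every combination of two or more rows, while a row has weight at
   most 7, so a coordinate permutation between two such codes permutes the rows.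
   For n > 1 the columns of D are the ones shared by several rows, hence they are
   permuted too, and the weight of a row tells whether its pair is an edge.

   Polynomial time is obtained once and for all: the words computed by nested
   loops over ranges of polynomial length are computed by stack machines, which
   are Turing machines whose tapes are read as stacks. *)

(** * Stack machines *)

(** Four is the least number of identity blocks for which the weight argument works: a row weighs at
    most 4 + 1 + 2 = 7 and a combination of k rows at least 4k, while three blocks would only give
    the bound 6 against rows of weight 6. The rows are indexed by ordered pairs rather than by edges
    so that the shape of the matrix depends on n alone and nested loops can write it. All entries
    are 0 or 1, so weights do not depend on the field, and two fixed names, one for 0 and one for 1,
    suffice to write every output. The map must also reject words that encode no pair of graphs.
    Instead of parsing, it tries every n below the length of the input, reads off two graphs, forces
    them to be simple, and compares their encoding with the input. If no n passes, the output is the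
    empty word, which is never an instance of code equivalence. *)

Section Machines.
Variables (S : finType) (K : nat).

Notation symbols := {ffun 'I_K.+1 -> cell S void}.
Notation memory := {ffun 'I_K.+1 -> tape S void}.

(** The number of tapes is fixed and [void] excludes auxiliary symbols, so that all machines share
    one type of memory and can be composed. *)
Record machine := Machine {
  mstate : finType;
  mstart : mstate;
  mdelta : mstate -> symbols ->
           option (mstate * {ffun 'I_K.+1 -> cell S void * direction}) }.

Definition tm_of (M : machine) : tm S := TM (@mstart M) (@mdelta M).

Definition runs (M : machine) (ts : memory) (t : nat) (ts' : memory) : Prop :=
  exists q : mstate M,
    @steps S (tm_of M) t (mstart M, ts) = Some (q, ts') /\
    @step S (tm_of M) (q, ts') = None.

(* A tape that reads u is a stack with content u, top first: popping is a move
   to the right, pushing a move to the left followed by a write. *)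
Definition stacks (ts : memory) (s : nat -> seq S) : Prop :=
  forall i : 'I_K.+1, tape_reads (ts i) (s i).

(** Quantifying over every memory that represents [s] makes composition possible: stacks do not
    constrain the cells left of the head, where popped letters remain. *)
Definition exec (M : machine) (s : nat -> seq S) (t : nat) (s' : nat -> seq S) :=
  forall ts, stacks ts s ->
  exists ts' t', [/\ t' <= t, runs M ts t' ts' & stacks ts' s'].

Definition upd (s : nat -> seq S) (r : nat) (v : seq S) : nat -> seq S :=
  fun i => if i == r then v else s i.

Definition top (c : cell S void) : option S :=
  if c is Some (inl a) then Some a else None.

Lemma top_scanned (t : tape S void) (u : seq S) :
  tape_reads t u -> top (scanned t) = ohead u.
Proof. by case: u => [|a u] [] [|m] //= [-> _]. Qed.

Lemma stepsS (M : tm S) (t : nat) (c : config M) :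
  steps t.+1 c = obind (steps t) (step c).
Proof. by []. Qed.

Lemma steps_add (M : tm S) (t1 t2 : nat) (c : config M) :
  steps (t1 + t2) c = obind (steps t2) (steps t1 c).
Proof. by elim: t1 c => //= t1 IH c; case: (step c) => //= c'; apply: IH. Qed.

Lemma exec_mono M s t1 t2 s' : t1 <= t2 -> exec M s t1 s' -> exec M s t2 s'.
Proof.
move=> le12 ex ts /ex[ts' [t' [le1 run out]]].
by exists ts', t'; split=> //; apply: leq_trans le12.
Qed.

Lemma exec_eqr M s t s1 s2 : s1 =1 s2 -> exec M s t s1 -> exec M s t s2.
Proof.
move=> eq12 ex ts /ex[ts' [t' [le1 run out]]].
by exists ts', t'; split=> // i; rewrite -eq12.
Qed.

Lemma exec_eql M t s1 s2 s' : s1 =1 s2 -> exec M s1 t s' -> exec M s2 t s'.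
Proof. by move=> eq12 ex ts ts_s2; apply: ex => i; rewrite eq12. Qed.

Definition idle (sc : symbols) : {ffun 'I_K.+1 -> cell S void * direction} :=
  [ffun i => (sc i, Stay)].

Lemma write_scanned (t : tape S void) : write (scanned t) t = t.
Proof. by case: t. Qed.

Lemma idle_memory (ts : memory) :
  [ffun i => move (idle [ffun j => scanned (ts j)] i).2
                  (write (idle [ffun j => scanned (ts j)] i).1 (ts i))] = ts.
Proof. by apply/ffunP=> i; rewrite !ffunE /= write_scanned. Qed.

Definition at_reg (r : nat) (sc : symbols) (c : cell S void) (dir : direction) :
    {ffun 'I_K.+1 -> cell S void * direction} :=
  [ffun i : 'I_K.+1 => if i == r :> nat then (c, dir) else (sc i, Stay)].

Definition skip : machine := @Machine unit tt (fun _ _ => None).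

Lemma exec_skip s : exec skip s 0 s.
Proof. by move=> ts ts_s; exists ts, 0; split=> //; exists tt. Qed.

Definition pop (r : nat) : machine :=
  @Machine bool true (fun q sc =>
    if q then Some (false, at_reg r sc (sc (inord r)) GoRight) else None).

Lemma reads_pop (t : tape S void) u :
  tape_reads t u -> tape_reads (move GoRight t) (behead u).
Proof.
case: t => l c r [m] /=; case: u => [|a u] /=.
  (* Popping an empty stack moves over a blank; if no blank is listed on the right, [move] supplies
     one. *)
  case: m => //= m [_ ->]; exists (maxn m 1).
  by case: m.
case=> _ ->; case: u => [|b u] /=; last by exists m.
by case: m => [|m]; [exists 1 | exists m.+1].
Qed.

Lemma exec_pop r s : r <= K -> exec (pop r) s 1 (upd s r (behead (s r))).
Proof.
move=> leK ts ts_s.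
exists [ffun i : 'I_K.+1 => if i == r :> nat then move GoRight (ts i) else ts i], 1.
split=> //; last first.
  move=> i; rewrite ffunE /upd; case: eqP => [<-|_]; last exact: ts_s.
  exact: reads_pop.
exists false; split=> //=.
rewrite /step /=; congr (Some (_, _)); apply/ffunP=> i; rewrite !ffunE /=.
case: eqP => [def_r|_]; rewrite /= ?ffunE ?write_scanned //.
by rewrite -def_r inord_val.
Qed.

(** A transition writes before it moves, so a push takes two of them. The head of [r] has already
    left the old top when [phi] is applied to the top of [x], whence [r != x] in [exec_push]. *)
Definition push (r x : nat) (phi : option S -> S) : machine :=
  @Machine (option bool) (Some true) (fun q sc =>
    match q with
    | Some true => Some (Some false, at_reg r sc (sc (inord r)) GoLeft)
    | Some false =>
        Some (None, at_reg r sc (letter void (phi (top (sc (inord x))))) Stay)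
    | None => None
    end).

Lemma exec_push r x phi s : r <= K -> x <= K -> r != x ->
  exec (push r x phi) s 2 (upd s r (phi (ohead (s x)) :: s r)).
Proof.
move=> rK xK neq_rx ts ts_s.
set a := phi _.
exists [ffun i : 'I_K.+1 => if i == r :> nat
   then write (letter void a) (move GoLeft (ts i)) else ts i], 2.
split=> //; last first.
  move=> i; rewrite ffunE /upd; case: eqP => [<-|_]; last exact: ts_s.
  by have [m /= ->] := ts_s i; exists m.
exists None; split=> //=.
rewrite /step /=; congr (Some (_, _)); apply/ffunP=> i; rewrite !ffunE /=.
rewrite !inordK // [x == r]eq_sym (negPf neq_rx) /=.
rewrite (top_scanned (ts_s _)) inordK // -/a.
by case: eqP => [def_r|_]; rewrite /= ?write_scanned // -def_r inord_val.
Qed.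

Lemma exec_pushc r a s : 0 < r <= K ->
  exec (push r 0 (fun=> a)) s 2 (upd s r (a :: s r)).
Proof. by case/andP=> r0 rK; apply: exec_push; rewrite // -lt0n. Qed.

(** * Control structures: sequence, conditional, loop *)

Section Seq.
Variables M1 M2 : machine.

(** The halting of [M1] shows only as [mdelta] being [None]; one idle step there hands the memory to
    [M2], which is the extra 1 in [exec_seq]. *)
Definition seqm : machine :=
  @Machine (mstate M1 + mstate M2)%type (inl (mstart M1)) (fun q sc =>
    match q with
    | inl q1 =>
        match mdelta q1 sc with
        | Some (q1', a) => Some (inl q1', a)
        | None => Some (inr (mstart M2), idle sc)
        end
    | inr q2 => omap (fun p => (inr p.1, p.2)) (mdelta q2 sc)
    end).

Lemma seqm_step1 q ts q' ts' :
  @step S (tm_of M1) (q, ts) = Some (q', ts') ->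
  @step S (tm_of seqm) (inl q, ts) = Some (inl q', ts').
Proof. by rewrite /step /=; case: mdelta => // -[q1 a] [<- <-]. Qed.

Lemma seqm_steps1 t q ts q' ts' :
  @steps S (tm_of M1) t (q, ts) = Some (q', ts') ->
  @steps S (tm_of seqm) t (inl q, ts) = Some (inl q', ts').
Proof.
elim: t q ts => [|t IH] q ts /=; first by case=> <- <-.
case E: (@step S (tm_of M1) (q, ts)) => [[q1 ts1]|] //= /IH.
by rewrite (seqm_step1 E).
Qed.

Lemma seqm_step2 q ts :
  @step S (tm_of seqm) (inr q, ts) =
  omap (fun c => (inr c.1, c.2)) (@step S (tm_of M2) (q, ts)).
Proof. by rewrite /step /=; case: mdelta => // -[]. Qed.

Lemma seqm_steps2 t q ts :
  @steps S (tm_of seqm) t (inr q, ts) =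
  omap (fun c => (inr c.1, c.2)) (@steps S (tm_of M2) t (q, ts)).
Proof.
elim: t q ts => [|t IH] q ts //=.
by rewrite seqm_step2; case: step => //= -[q' ts']; rewrite IH.
Qed.

Lemma seqm_switch q ts :
  @step S (tm_of M1) (q, ts) = None ->
  @step S (tm_of seqm) (inl q, ts) = Some (inr (mstart M2), ts).
Proof.
rewrite /step /=; case: mdelta => [[]|] // _.
by rewrite [in LHS]/scan idle_memory.
Qed.

Lemma exec_seq s t1 s1 t2 s2 :
  exec M1 s t1 s1 -> exec M2 s1 t2 s2 -> exec seqm s (t1 + t2 + 1) s2.
Proof.
move=> ex1 ex2 ts /ex1[ts1 [t1' [le1 [q1 [run1 halt1]]]]].
move=> /ex2[ts2 [t2' [le2 [q2 [run2 halt2]] out]]].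
exists ts2, (t1' + (1 + t2')); split=> //; first lia.
exists (inr q2); split; last by rewrite seqm_step2 halt2.
rewrite steps_add (seqm_steps1 run1) [obind _ _]/=.
by rewrite (seqm_switch halt1) /= seqm_steps2 run2.
Qed.
End Seq.

Section If.
Variables (test : option S -> option S -> bool) (x y : nat) (M1 M2 : machine).

Definition holds (s : nat -> seq S) : bool := test (ohead (s x)) (ohead (s y)).

Definition holds_at (sc : symbols) : bool :=
  test (top (sc (inord x))) (top (sc (inord y))).

Lemma holds_stacks ts s : x <= K -> y <= K -> stacks ts s ->
  holds_at [ffun i => scanned (ts i)] = holds s.
Proof.
move=> xK yK ts_s; rewrite /holds_at /holds !ffunE.
by rewrite !(top_scanned (ts_s _)) !inordK.
Qed.

Definition ifm : machine :=
  @Machine (option (mstate M1 + mstate M2)%type) None (fun q sc =>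
    match q with
    | None => Some (Some (if holds_at sc then inl (mstart M1)
                          else inr (mstart M2)), idle sc)
    | Some (inl q1) => omap (fun p => (Some (inl p.1), p.2)) (mdelta q1 sc)
    | Some (inr q2) => omap (fun p => (Some (inr p.1), p.2)) (mdelta q2 sc)
    end).

Lemma ifm_step1 q ts :
  @step S (tm_of ifm) (Some (inl q), ts) =
  omap (fun c => (Some (inl c.1), c.2)) (@step S (tm_of M1) (q, ts)).
Proof. by rewrite /step /=; case: mdelta => // -[]. Qed.

Lemma ifm_steps1 t q ts :
  @steps S (tm_of ifm) t (Some (inl q), ts) =
  omap (fun c => (Some (inl c.1), c.2)) (@steps S (tm_of M1) t (q, ts)).
Proof.
elim: t q ts => [|t IH] q ts //=.
by rewrite ifm_step1; case: step => //= -[q' ts']; rewrite IH.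
Qed.

Lemma ifm_step2 q ts :
  @step S (tm_of ifm) (Some (inr q), ts) =
  omap (fun c => (Some (inr c.1), c.2)) (@step S (tm_of M2) (q, ts)).
Proof. by rewrite /step /=; case: mdelta => // -[]. Qed.

Lemma ifm_steps2 t q ts :
  @steps S (tm_of ifm) t (Some (inr q), ts) =
  omap (fun c => (Some (inr c.1), c.2)) (@steps S (tm_of M2) t (q, ts)).
Proof.
elim: t q ts => [|t IH] q ts //=.
by rewrite ifm_step2; case: step => //= -[q' ts']; rewrite IH.
Qed.

Lemma ifm_start ts :
  @step S (tm_of ifm) (None, ts) =
  Some (Some (if holds_at [ffun i => scanned (ts i)] then inl (mstart M1)
              else inr (mstart M2)), ts).
Proof. by rewrite /step /= [in LHS]/scan idle_memory. Qed.

Lemma exec_if s t s' : x <= K -> y <= K ->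
  (if holds s then exec M1 s t s' else exec M2 s t s') ->
  exec ifm s t.+1 s'.
Proof.
move=> xK yK ex ts ts_s; move: ex (ifm_start ts).
rewrite (holds_stacks xK yK ts_s).
case: ifP => _ /(_ ts ts_s)[ts' [t' [le [q [run halt]] out]]] start;
  exists ts', t'.+1; split=> //.
- exists (Some (inl q)); split; last by rewrite ifm_step1 halt.
  by rewrite stepsS start [LHS]/= ifm_steps1 run.
- exists (Some (inr q)); split; last by rewrite ifm_step2 halt.
  by rewrite stepsS start [LHS]/= ifm_steps2 run.
Qed.
End If.

Section While.
Variables (test : option S -> option S -> bool) (x y : nat) (M : machine).

Definition whilem : machine :=
  @Machine (option (mstate M)) None (fun q sc =>
    match q with
    | None =>
        if holds_at test x y sc then Some (Some (mstart M), idle sc) else None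
    | Some q1 =>
        match mdelta q1 sc with
        | Some (q1', a) => Some (Some q1', a)
        | None => Some (None, idle sc)
        end
    end).

Lemma whilem_step q ts q' ts' :
  @step S (tm_of M) (q, ts) = Some (q', ts') ->
  @step S (tm_of whilem) (Some q, ts) = Some (Some q', ts').
Proof. by rewrite /step /=; case: mdelta => // -[q1 a] [<- <-]. Qed.

Lemma whilem_steps t q ts q' ts' :
  @steps S (tm_of M) t (q, ts) = Some (q', ts') ->
  @steps S (tm_of whilem) t (Some q, ts) = Some (Some q', ts').
Proof.
elim: t q ts => [|t IH] q ts /=; first by case=> <- <-.
case E: (@step S (tm_of M) (q, ts)) => [[q1 ts1]|] //= /IH.
by rewrite (whilem_step E).
Qed.

Lemma whilem_switch q ts :
  @step S (tm_of M) (q, ts) = None ->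
  @step S (tm_of whilem) (Some q, ts) = Some (None, ts).
Proof.
rewrite /step /=; case: mdelta => [[]|] // _.
by rewrite [in LHS]/scan idle_memory.
Qed.

Lemma whilem_start ts :
  @step S (tm_of whilem) (None, ts) =
  if holds_at test x y [ffun i => scanned (ts i)]
  then Some (Some (mstart M), ts) else None.
Proof. by rewrite /step /= [in LHS]/scan; case: holds_at; rewrite ?idle_memory. Qed.

(** [s i] describes the stacks after [i] rounds. Besides its body, a round spends one step on the
    test and one on returning to it; the failing test is the halting itself and costs nothing. *)
Lemma exec_while (k t : nat) (s : nat -> nat -> seq S) : x <= K -> y <= K ->
  (forall i, i < k -> holds test x y (s i)) -> ~~ holds test x y (s k) ->
  (forall i, i < k -> exec M (s i) t (s i.+1)) ->
  exec whilem (s 0) (k * t.+2) (s k).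
Proof.
move=> xK yK; elim: k s => [|k IH] s hold nhold ex ts ts_s.
  exists ts, 0; split=> //; exists None; split=> //.
  by rewrite whilem_start (holds_stacks test xK yK ts_s) (negPf nhold).
have [ts1 [t1 [le1 [q1 [run1 halt1]] out1]]] := ex 0 isT ts ts_s.
have [||i lti|ts2 [t2 [le2 [q2 [run2 halt2]] out2]]] :=
  IH (fun i => s i.+1) _ _ _ ts1 out1 => //.
- by move=> i lti; apply: hold.
- exact: ex.
exists ts2, (1 + (t1 + (1 + t2))); split=> //; first by rewrite mulSn; lia.
exists q2; split=> //; rewrite add1n stepsS whilem_start (holds_stacks test xK yK ts_s) (hold 0) //.
rewrite [LHS]/= steps_add (whilem_steps run1) [obind _ _]/=.
by rewrite (whilem_switch halt1).
Qed.
End While.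

End Machines.

Lemma upd_same (S : finType) (s : nat -> seq S) r v : upd s r v r = v.
Proof. by rewrite /upd eqxx. Qed.

Lemma upd_other (S : finType) (s : nat -> seq S) r v i :
  i != r -> upd s r v i = s i.
Proof. by rewrite /upd => /negPf->. Qed.

Ltac case_regs :=
  rewrite /upd; repeat (match goal with
  | |- context [@eq_op _ ?a ?b] =>
    match type of a with nat => case: (eqVneq a b) => ? end
  end; try (exfalso; lia)); simpl.

(** * Subroutines on stacks: copying, comparison, indexed access *)

Section StackPrograms.
Variables (S : finType) (u : S) (K : nat).
Implicit Types (s : nat -> seq S) (x y z r : nat).

Definition nonempty (a b : option S) : bool := a.

Definition clear x : machine S K := whilem nonempty x x (pop S K x).

Lemma exec_clear x s : x <= K -> exec (clear x) s (size (s x) * 3) (upd s x [::]).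
Proof.
move=> xK; pose s_ i := upd s x (drop i (s x)).
apply: (@exec_eql _ _ _ _ (s_ 0)) => [i|].
  by rewrite /s_ drop0 /upd; case: eqP => // ->.
apply: (@exec_eqr _ _ _ _ _ (s_ (size (s x)))) => [i|].
  by rewrite /s_ drop_size.
apply: exec_while => // [i lti||i lti].
- by rewrite /holds /s_ upd_same (drop_nth u lti).
- by rewrite /holds /s_ upd_same drop_size.
- apply: (exec_eqr _ (exec_pop xK)) => j.
  by rewrite /s_ upd_same (drop_nth u lti) /upd; case: eqP.
Qed.

Definition transfer x y : machine S K :=
  whilem nonempty x x (seqm (push K y x (odflt u)) (pop S K x)).

Lemma exec_transfer x y s : x <= K -> y <= K -> x != y ->
  exec (transfer x y) s (size (s x) * 6)
    (upd (upd s y (rev (s x) ++ s y)) x [::]).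
Proof.
move=> xK yK xy.
pose s_ i := upd (upd s y (rev (take i (s x)) ++ s y)) x (drop i (s x)).
apply: (@exec_eql _ _ _ _ (s_ 0)) => [i|].
  by rewrite /s_ drop0 take0 /upd; do 2?[case: eqP => [->|] //].
apply: (@exec_eqr _ _ _ _ _ (s_ (size (s x)))) => [i|].
  by rewrite /s_ drop_size take_size.
apply: exec_while => // [i lti||i lti].
- by rewrite /holds /s_ upd_same (drop_nth u lti).
- by rewrite /holds /s_ upd_same drop_size.
- rewrite -[4]/(2 + 1 + 1); apply: exec_seq.
    by apply: exec_push; rewrite // eq_sym.
  apply: (exec_eqr _ (exec_pop xK)) => j.
  rewrite /s_ (take_nth u lti) (drop_nth u lti) rev_rcons.
  by case_regs; congruence.
Qed.

Definition restore z x r (phi : S -> S) : machine S K :=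
  whilem nonempty z z
    (seqm (push K x z (odflt u)) (seqm (push K r z (fun a => phi (odflt u a)))
      (pop S K z))).

Lemma exec_restore z x r phi s : z <= K -> x <= K -> r <= K ->
    z != x -> z != r -> x != r ->
  exec (restore z x r phi) s (size (s z) * 9)
    (upd (upd (upd s x (rev (s z) ++ s x))
      r (rev (map phi (s z)) ++ s r)) z [::]).
Proof.
move=> zK xK rK zx zr xr.
pose s_ i := upd (upd (upd s x (rev (take i (s z)) ++ s x))
      r (rev (map phi (take i (s z))) ++ s r)) z (drop i (s z)).
apply: (@exec_eql _ _ _ _ (s_ 0)) => [i|].
  by rewrite /s_ drop0 take0 /upd; do 3?[case: eqP => [->|] //].
apply: (@exec_eqr _ _ _ _ _ (s_ (size (s z)))) => [i|].
  by rewrite /s_ drop_size take_size.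
apply: exec_while => // [i lti||i lti].
- by rewrite /holds /s_ upd_same (drop_nth u lti).
- by rewrite /holds /s_ upd_same drop_size.
- rewrite -[7]/(2 + (2 + 1 + 1) + 1); apply: exec_seq.
    by apply: exec_push; rewrite // eq_sym.
  apply: exec_seq; first by apply: exec_push; rewrite // eq_sym.
  apply: (exec_eqr _ (exec_pop zK)) => j.
  rewrite /s_ (take_nth u lti) (drop_nth u lti) map_rcons !rev_rcons.
  by case_regs; congruence.
Qed.

(** A stack can be read only by emptying it. Reversing [x] onto the scratch stack [z] and emptying
    [z] again restores [x] and delivers the image to [r], both in the original order. *)
Definition copy x z r phi : machine S K := seqm (transfer x z) (restore z x r phi).

Lemma exec_copy x z r phi s : z <= K -> x <= K -> r <= K ->
    z != x -> z != r -> x != r -> s z = [::] ->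
  exec (copy x z r phi) s (size (s x) * 15 + 1) (upd s r (map phi (s x) ++ s r)).
Proof.
move=> zK xK rK zx zr xr s_z.
rewrite (_ : 15 = 6 + 9) // mulnDr; apply: exec_seq.
  by apply: exec_transfer; rewrite // eq_sym.
set s1 := upd _ _ _.
have s1z : s1 z = rev (s x) by rewrite /s1 upd_other // upd_same s_z cats0.
apply: (exec_eqr _ (exec_mono _ (exec_restore phi zK xK rK zx zr xr))); last first.
  by rewrite s1z size_rev.
by move=> i; rewrite s1z map_rev !revK /s1; case_regs; rewrite ?cats0; congruence.
Qed.

Definition both_empty (a b : option S) : bool := ~~ a && ~~ b.

Definition same_top (a b : option S) : bool := a && (a == b).

Definition compare x y r : machine S K :=
  seqm (whilem same_top x y (seqm (pop S K x) (pop S K y)))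
 (seqm (ifm both_empty x y (push K r 0 (fun=> u)) (skip S K))
 (seqm (clear x) (clear y))).

(** The number of rounds of the loop in [compare]; the words are equal exactly when both stacks are
    empty after it. *)
Fixpoint common_prefix (v1 v2 : seq S) : nat :=
  match v1, v2 with
  | a :: v1', b :: v2' => if a == b then (common_prefix v1' v2').+1 else 0
  | _, _ => 0
  end.

Lemma common_prefix_le v1 v2 : common_prefix v1 v2 <= size v1.
Proof. by elim: v1 v2 => [|a v1 IH] [|b v2] //=; case: eqP => // _; apply: IH. Qed.

Lemma common_prefix_same v1 v2 i : i < common_prefix v1 v2 ->
  same_top (ohead (drop i v1)) (ohead (drop i v2)).
Proof.
elim: v1 v2 i => [|a v1 IH] [|b v2] //= i; case: eqVneq => // <-.
case: i => [|i]; first by rewrite /same_top /= eqxx.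
by rewrite ltnS; apply: IH.
Qed.

Lemma common_prefix_differ v1 v2 : ~~ same_top
  (ohead (drop (common_prefix v1 v2) v1)) (ohead (drop (common_prefix v1 v2) v2)).
Proof.
elim: v1 v2 => [|a v1 IH] [|b v2] //=; case: eqVneq => //= ab.
Qed.

Lemma common_prefix_eq v1 v2 :
  both_empty (ohead (drop (common_prefix v1 v2) v1))
             (ohead (drop (common_prefix v1 v2) v2)) = (v1 == v2).
Proof.
elim: v1 v2 => [|a v1 IH] [|b v2] //=; rewrite eqseq_cons.
by case: eqVneq => //= _.
Qed.

Lemma exec_compare x y r s : x <= K -> y <= K -> 0 < r <= K ->
    x != y -> r != x -> r != y ->
  exec (compare x y r) s (size (s x) * 8 + size (s y) * 3 + 6)
    (upd (upd (upd s r (nseq (s x == s y) u ++ s r)) x [::]) y [::]).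
Proof.
move=> xK yK r0K xy rx ry.
set k := common_prefix (s x) (s y).
pose s_ i := upd (upd s x (drop i (s x))) y (drop i (s y)).
have szx i : size (drop i (s x)) <= size (s x) by rewrite size_drop leq_subr.
have szy i : size (drop i (s y)) <= size (s y) by rewrite size_drop leq_subr.
have kx := common_prefix_le (s x) (s y).
apply: (@exec_mono _ _ _ _
  (k * (3 + 2) + (3 + (size (drop k (s x)) * 3 + size (drop k (s y)) * 3 + 1) + 1) + 1)).
  by rewrite -/k in kx; move: (szx k) (szy k); lia.
have s_x i : s_ i x = drop i (s x) by rewrite /s_ upd_other // upd_same.
have s_y i : s_ i y = drop i (s y) by rewrite /s_ upd_same.
apply: (@exec_seq _ _ _ _ _ _ (s_ k)).
  apply: (@exec_eql _ _ _ _ (s_ 0)) => [i|].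
    by rewrite /s_ !drop0 /upd; do 2?[case: eqP => [->|] //].
  apply: exec_while => // [i lti||i lti].
  - by rewrite /holds s_x s_y common_prefix_same.
  - by rewrite /holds s_x s_y common_prefix_differ.
  - rewrite -[3]/(1 + 1 + 1); apply: exec_seq; first exact: exec_pop.
    apply: (exec_eqr _ (exec_pop yK)) => j.
    rewrite [upd _ _ _ y]upd_other ?s_x ?s_y; last by rewrite eq_sym.
    rewrite -!drop1 !drop_drop !add1n /s_.
    by case_regs; congruence.
apply: exec_seq.
  pose s1 := upd (s_ k) r (nseq (s x == s y) u ++ s r).
  apply: (@exec_if _ _ _ _ _ _ _ _ _ s1) => //.
  have s_r : s_ k r = s r by rewrite /s_ !upd_other.
  rewrite /holds s_x s_y common_prefix_eq /s1 -s_r.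
  case: (s x == s y) => /=; first by apply: (exec_eqr _ (exec_pushc u r0K)).
  apply: (exec_mono _ (exec_eqr _ (@exec_skip _ _ _))) => // i.
  by rewrite /upd; case: eqP => // ->.
apply: exec_seq.
  apply: (exec_mono _ (exec_clear xK)).
  by rewrite upd_other ?s_x // eq_sym.
apply: (exec_eqr _ (exec_mono _ (exec_clear yK))).
  by move=> i; rewrite /s_; case_regs; congruence.
rewrite upd_other; last by rewrite eq_sym.
by rewrite upd_other ?s_y // eq_sym.
Qed.

Definition both_nonempty (a b : option S) : bool := a && b.

Definition second_only (a b : option S) : bool := ~~ a && b.

(** Each round discards one letter of the index [x] and moves one input letter to [y]. When the
    index runs out first, the top of stack 0 is the letter sought; when the input is exhausted,
    nothing is pushed. Finally [y] is poured back to rebuild the input. *)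
Definition lookup x y r : machine S K :=
  seqm (whilem both_nonempty x 0 (seqm (push K y 0 (odflt u))
         (seqm (pop S K 0) (pop S K x))))
 (seqm (ifm second_only x 0 (push K r 0 (odflt u)) (skip S K))
 (seqm (clear x) (transfer y 0))).

Lemma exec_lookup x y r s : 0 < x <= K -> 0 < y <= K -> 0 < r <= K ->
    x != y -> r != x -> r != y -> s y = [::] ->
  exec (lookup x y r) s (size (s x) * 3 + size (s 0) * 14 + 6)
    (upd (upd s r (take 1 (drop (size (s x)) (s 0)) ++ s r)) x [::]).
Proof.
move=> /andP[x0 xK] /andP[y0 yK] /andP[r0 rK] xy rx ry sy.
set w := s 0; set k := minn (size (s x)) (size w).
pose s_ i := upd (upd (upd s x (drop i (s x))) y (rev (take i w))) 0 (drop i w).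
have szx i : size (drop i (s x)) <= size (s x) by rewrite size_drop leq_subr.
have kw : k <= size w by exact: geq_minr.
have tkw : size (take k w) <= size w by rewrite size_take; case: ifP => // /ltnW.
have s_x i : s_ i x = drop i (s x) by rewrite /s_ 2?upd_other ?upd_same //; lia.
have s_y i : s_ i y = rev (take i w) by rewrite /s_ upd_other ?upd_same //; lia.
have s_0 i : s_ i 0 = drop i w by rewrite /s_ upd_same.
apply: (@exec_mono _ _ _ _
  (k * (6 + 2) + (3 + (size (drop k (s x)) * 3 + size (take k w) * 6 + 1) + 1) + 1)).
  by move: (szx k); lia.
apply: (@exec_seq _ _ _ _ _ _ (s_ k)).
  apply: (@exec_eql _ _ _ _ (s_ 0)) => [i|].
    rewrite /s_ !drop0 take0 /upd.
    have y_w : s y = rev [::] by [].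
    by rewrite /w; case_regs; congruence.
  apply: exec_while => // [i lti||i lti].
  - have [lt1 lt2] : i < size (s x) /\ i < size w by lia.
    by rewrite /holds s_x s_0 (drop_nth u lt1) (drop_nth u lt2).
  - rewrite /holds s_x s_0 /k /minn; case: ltnP => _.
      by rewrite drop_size.
    by rewrite [drop _ w]drop_oversize // /both_nonempty andbF.
  - rewrite -[6]/(2 + (1 + 1 + 1) + 1); apply: exec_seq.
      by apply: exec_push => //; lia.
    apply: exec_seq; first exact: exec_pop.
    apply: (exec_eqr _ (exec_pop xK)) => j.
    have ltw : i < size w by lia.
    have hd_w : ohead (drop i w) = Some (nth u w i) by rewrite (drop_nth u ltw).
    have tl v : behead (drop i v) = drop i.+1 v by rewrite -drop1 drop_drop.
    rewrite s_0 s_y hd_w /s_ (take_nth u ltw) rev_rcons /=.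
    by case_regs; rewrite ?tl; congruence.
apply: exec_seq.
  pose s1 := upd (s_ k) r (take 1 (drop (size (s x)) w) ++ s r).
  apply: (@exec_if _ _ _ _ _ _ _ _ _ s1) => //.
  have s_r : s_ k r = s r by rewrite /s_ !upd_other //; lia.
  rewrite /holds s_x s_0 /s1 -s_r /second_only.
  have [lt|ge] := ltnP (size (s x)) (size w).
    have -> : k = size (s x) by lia.
    rewrite drop_size (drop_nth u lt) /=.
    apply: (exec_eqr _ (@exec_push _ _ _ _ _ _ rK (leq0n K) _)); last lia.
    by move=> i; rewrite s_0 (drop_nth u lt) take0.
  have -> : k = size w by lia.
  rewrite drop_size andbF [drop _ w]drop_oversize //=.
  apply: (exec_mono _ (exec_eqr _ (@exec_skip _ _ _))) => // i.
  by rewrite /upd; case: eqP => // ->.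
apply: exec_seq.
  apply: (exec_mono _ (exec_clear xK)).
  by rewrite upd_other ?s_x // eq_sym.
apply: (exec_eqr _ (exec_mono _ (exec_transfer yK (leq0n K) _))).
- move=> i; rewrite /s_; case_regs; rewrite ?sy ?revK ?cat_take_drop; rewrite /w; congruence.
- rewrite upd_other; last by rewrite eq_sym.
  by rewrite upd_other ?s_y ?size_rev // eq_sym.
- lia.
Qed.

End StackPrograms.

(** * Loop expressions *)

Section LoopExpressions.
Variables (S : finType) (u : S).

(* Natural numbers are words read through their size.  [For l1 l2] concatenates
   the values of l2 for its innermost variable ranging over 0, ..., |l1| - 1;
   variables are de Bruijn indices, and [Tick k] is the k-th one in unary. *)
Inductive lexp :=
  | Empty
  | Single of S
  | Cat of lexp & lexp
  | Input
  | Tick of nat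
  | For of lexp & lexp
  | Same of lexp & lexp
  | Letter of lexp.

Fixpoint eval (w : seq S) (rho : seq nat) (l : lexp) : seq S :=
  match l with
  | Empty => [::]
  | Single a => [:: a]
  | Cat l1 l2 => eval w rho l1 ++ eval w rho l2
  | Input => w
  | Tick k => nseq (nth (size w) rho k) u
  | For l1 l2 =>
      flatten [seq eval w (i :: rho) l2 | i <- iota 0 (size (eval w rho l1))]
  | Same l1 l2 => nseq (eval w rho l1 == eval w rho l2) u
  | Letter l1 => take 1 (drop (size (eval w rho l1)) w)
  end.

(** The number of scratch stacks used from [d] on: one for a copy or a loop counter, two for the
    operands of a comparison or for an index and the letters set aside by [lookup]. *)
Fixpoint depth (l : lexp) : nat :=
  match l with
  | Empty | Single _ => 0
  | Cat l1 l2 => maxn (depth l1) (depth l2)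
  | Input | Tick _ => 1
  | For l1 l2 => 1 + maxn (depth l1) (depth l2)
  | Same l1 l2 => 2 + maxn (depth l1) (depth l2)
  | Letter l1 => 2 + depth l1
  end.

(* Stack 0 holds the input, vs lists the stacks holding the variables, the
   stacks from d on are free, and the value is pushed onto stack r.  An index
   out of scope falls back on stack 0, whence the default value in [eval]. *)
Fixpoint compile (K : nat) (vs : seq nat) (d r : nat) (l : lexp) : machine S K :=
  match l with
  | Empty => skip S K
  | Single a => push K r 0 (fun=> a)
  | Cat l1 l2 => seqm (compile K vs d r l2) (compile K vs d r l1)
  | Input => copy u K 0 d r id
  | Tick k => copy u K (nth 0 vs k) d r (fun=> u)
  | For l1 l2 =>
      seqm (compile K vs d.+1 d l1)
           (whilem (@nonempty S) d d
              (seqm (pop S K d) (compile K (d :: vs) d.+1 r l2)))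
  | Same l1 l2 =>
      seqm (compile K vs d.+2 d l1)
     (seqm (compile K vs d.+2 d.+1 l2) (compare u K d d.+1 r))
  | Letter l1 =>
      seqm (compile K vs d.+2 d l1) (lookup u K d d.+1 r)
  end.

(** Bounds both running time and length of the value when [m] bounds the input and all variables. A
    loop variable is bounded by the cost of its range, hence the enlarged argument for the body. *)
Fixpoint cost (l : lexp) (m : nat) : nat :=
  match l with
  | Empty => 0
  | Single _ => 2
  | Cat l1 l2 => cost l1 m + cost l2 m + 1
  | Input | Tick _ => m * 15 + 1
  | For l1 l2 => cost l1 m + cost l1 m * (cost l2 (m + cost l1 m) + 4) + 1
  | Same l1 l2 => cost l1 m * 9 + cost l2 m * 4 + 8
  | Letter l1 => cost l1 m * 4 + m * 14 + 7
  end.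

Lemma size_flatten_iota (g : nat -> seq S) (n c : nat) :
  (forall i, i < n -> size (g i) <= c) ->
  size (flatten [seq g i | i <- iota 0 n]) <= n * c.
Proof.
move=> le_c; rewrite -[n in n * c](size_iota 0).
have: {in iota 0 n, forall i, size (g i) <= c}.
  by move=> i; rewrite mem_iota => /andP[_ /le_c].
elim: (iota 0 n) => //= i s IH le_s.
rewrite size_cat mulSn leq_add ?le_s ?mem_head // IH // => j sj.
by rewrite le_s // in_cons sj orbT.
Qed.

Lemma size_eval l w rho m : size w <= m -> {in rho, forall i, i <= m} ->
  size (eval w rho l) <= cost l m.
Proof.
elim: l rho m => [|a|l1 IH1 l2 IH2||k|l1 IH1 l2 IH2|l1 IH1 l2 IH2|l1 IH1]
  rho m wm rm /=; rewrite ?size_cat ?size_nseq //.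
- by move: (IH1 _ _ wm rm) (IH2 _ _ wm rm); lia.
- by lia.
- have: nth (size w) rho k <= m.
    have [lt|ge] := ltnP k (size rho); last by rewrite nth_default.
    by rewrite rm // mem_nth.
  by lia.
- have le1 := IH1 _ _ wm rm.
  apply: leq_trans (size_flatten_iota (c := cost l2 (m + cost l1 m)) _) _.
    move=> i lti; apply: IH2; first by lia.
    move=> j; rewrite in_cons => /predU1P[->|/rm]; lia.
  by nia.
- by case: eqP; lia.
- by rewrite size_take; case: ifP; lia.
Qed.

Lemma flatten_iota_drop (g : nat -> seq S) (n i : nat) : i < n ->
  flatten [seq g j | j <- iota (n - i.+1) i.+1] =
  g (n - i.+1) ++ flatten [seq g j | j <- iota (n - i) i].
Proof. by move=> lt; rewrite /= subnSK. Qed.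

(** Since values are pushed, they are produced from right to left: [Cat] runs its second part first,
    and a loop counts its variable down by popping the counter before the body. The result stack
    must avoid the scratch area and the variables, which are read again later. *)
Lemma compileP l (K : nat) (vs : seq nat) (d r m : nat) (s : nat -> seq S) :
    0 < d -> d + depth l <= K.+1 -> 0 < r <= K ->
    (r < d) || (d + depth l <= r) -> r \notin vs -> {in vs, forall x, x < d} ->
    (forall i, d <= i < d + depth l -> s i = [::]) ->
    size (s 0) <= m -> {in vs, forall x, size (s x) <= m} ->
  exec (compile K vs d r l) s (cost l m)
    (upd s r (eval (s 0) [seq size (s x) | x <- vs] l ++ s r)).
Proof.
elim: l vs d r m s => [|a|l1 IH1 l2 IH2||k|l1 IH1 l2 IH2|l1 IH1 l2 IH2|l1 IH1]
  vs d r m s d0 dK rK rd rvs vsd empt s0m vsm /=; rewrite /= in dK rd empt.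
- by apply: (exec_eqr _ (@exec_skip _ _ _)) => i; case_regs; congruence.
- exact: exec_pushc.
- set s1 := upd s r (eval (s 0) [seq size (s x) | x <- vs] l2 ++ s r).
  have s1x x : x != r -> s1 x = s x by rewrite /s1 => /upd_other->.
  have vsr x : x \in vs -> x != r by move=> xvs; apply: contraNneq rvs => <-.
  apply: (exec_mono _ (exec_seq (s1 := s1) (IH2 _ _ _ m _ _ _ _ _ _ _ _ _ _)
    (exec_eqr _ (IH1 _ _ _ m _ _ _ _ _ _ _ _ _ _)))) => //; try lia.
  + by move=> i le_i; apply: empt; lia.
  + move=> i; rewrite s1x; last lia.
    have ->: [seq size (s1 x) | x <- vs] = [seq size (s x) | x <- vs].
      by apply/eq_in_map => x xvs; rewrite s1x ?vsr.
    by rewrite -catA /s1; case_regs.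
  + by move=> i le_i; rewrite s1x ?empt //; lia.
  + by rewrite s1x; lia.
  + by move=> x xvs; rewrite s1x ?vsr ?vsm.
- apply: (exec_mono _ (exec_eqr _ (exec_copy _ _ _ _ _ _ _ _ _))); try lia.
  + by move=> i; rewrite map_id.
  + by apply: empt; lia.
- set x := nth 0 vs k.
  have [lt|ge] := ltnP k (size vs).
    have xvs : x \in vs by rewrite mem_nth.
    have := vsd _ xvs; have := vsm _ xvs => xm xd.
    have xr : x != r by apply: contraNneq rvs => <-.
    apply: (exec_mono _ (exec_eqr _ (exec_copy _ _ _ _ _ _ _ _ _))); try lia.
    * move=> i; rewrite (nth_map 0) // -/x.
      by congr (upd _ _ (_ ++ _) _); elim: (s x) => //= a v ->.
    * by apply: empt; lia.
  have -> : x = 0 by rewrite /x nth_default.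
  apply: (exec_mono _ (exec_eqr _ (exec_copy _ _ _ _ _ _ _ _ _))); try lia.
  + move=> i; rewrite nth_default ?size_map //.
    by congr (upd _ _ (_ ++ _) _); elim: (s 0) => //= a v ->.
  + by apply: empt; lia.
- set rho := [seq size (s x) | x <- vs]; set v := eval _ rho l1.
  have rhom : {in rho, forall i, i <= m} by move=> _ /mapP[x /vsm xm ->].
  have le1 : size v <= cost l1 m by apply: size_eval.
  set g := fun i => eval (s 0) (i :: rho) l2.
  have vsr x : x \in vs -> x != r by move=> xvs; apply: contraNneq rvs => <-.
  have sd : s d = [::] by apply: empt; lia.
  (* After [i] rounds the counter has lost [i] letters and [r] carries the values for the last [i]
     indices. *)
  pose s_ i := upd (upd s d (drop i v)) r
    (flatten [seq g j | j <- iota (size v - i) i] ++ s r).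
  set c := cost l2 (m + cost l1 m).
  apply: (@exec_mono _ _ _ _ (cost l1 m + size v * (1 + c + 1).+2 + 1)).
    by apply: leq_add => //; rewrite leq_add2l leq_mul //; lia.
  apply: (exec_seq (s1 := upd s d (v ++ s d))).
    apply: IH1 => //; try lia.
    * by apply/negP=> /vsd; lia.
    * by move=> x /vsd; lia.
    * by move=> i le_i; apply: empt; lia.
  apply: (exec_eql (s1 := s_ 0)) => [i|].
    by rewrite /s_ drop0 sd cats0 /=; case_regs; congruence.
  apply: (exec_eqr (s1 := s_ (size v))) => [i|].
    by rewrite /s_ subnn drop_size; case_regs; try congruence.
  have s_d i : s_ i d = drop i v by rewrite /s_ upd_other ?upd_same //; lia.
  apply: exec_while => [||i lti||i lti]; try lia.
  + by rewrite /holds s_d (drop_nth u lti).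
  + by rewrite /holds s_d drop_size.
  + set s1 := upd (s_ i) d (drop i.+1 v).
    have s1x x : x != d -> x != r -> s1 x = s x.
      by move=> xd xr; rewrite /s1 /s_ !upd_other.
    apply: (exec_seq (s1 := s1)).
      apply: (exec_eqr _ (exec_pop _)); last lia.
      by move=> j; rewrite s_d (drop_nth u lti).
    have s1vs x : x \in vs -> s1 x = s x.
      by move=> xvs; rewrite s1x ?vsr //; move: (vsd _ xvs); lia.
    apply: (exec_eqr _ (IH2 _ _ _ _ _ _ _ _ _ _ _ _ _ _)) => //; try lia.
    * move=> j /=; rewrite (s1x 0); try lia.
      have ->: [seq size (s1 x) | x <- vs] = rho by apply/eq_in_map => x /s1vs->.
      rewrite /s1 upd_same /s_ size_drop flatten_iota_drop // -catA -/(g _).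
      rewrite [upd _ d _ r]upd_other; last lia.
      by rewrite upd_same; case_regs; congruence.
    * by rewrite in_cons negb_or rvs andbT; lia.
    * by move=> x; rewrite in_cons => /predU1P[->//|/vsd]; lia.
    * by move=> j le_j; rewrite s1x ?empt //; lia.
    * by rewrite s1x; lia.
    * move=> x; rewrite in_cons => /predU1P[->|xvs].
        by rewrite /s1 upd_same size_drop; lia.
      by rewrite s1vs //; move: (vsm _ xvs); lia.
- set rho := [seq size (s x) | x <- vs].
  set v1 := eval _ rho l1; set v2 := eval _ rho l2.
  have rhom : {in rho, forall i, i <= m} by move=> _ /mapP[x /vsm xm ->].
  have le1 : size v1 <= cost l1 m by apply: size_eval.
  have le2 : size v2 <= cost l2 m by apply: size_eval.
  have sd : s d = [::] by apply: empt; lia.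
  have sd1 : s d.+1 = [::] by apply: empt; lia.
  pose s1 := upd s d v1; pose s2 := upd s1 d.+1 v2.
  have s1vs x : x \in vs -> s1 x = s x.
    by move=> /vsd xd; rewrite /s1 upd_other //; lia.
  have s10 : s1 0 = s 0 by rewrite /s1 upd_other //; lia.
  have s1d1 : s1 d.+1 = [::] by rewrite /s1 upd_other //; lia.
  apply: (@exec_mono _ _ _ _
    (cost l1 m + (cost l2 m + (size v1 * 8 + size v2 * 3 + 6) + 1) + 1)); first lia.
  apply: (exec_seq (s1 := s1)).
    apply: (exec_eqr _ (IH1 _ _ _ m _ _ _ _ _ _ _ _ _ _)) => //; try lia.
    * by move=> j; rewrite sd cats0.
    * by apply/negP=> /vsd; lia.
    * by move=> x /vsd; lia.
    * by move=> j le_j; apply: empt; lia.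
  apply: (exec_seq (s1 := s2)).
    apply: (exec_eqr _ (IH2 _ _ _ m _ _ _ _ _ _ _ _ _ _)) => //; try lia.
    * move=> j; rewrite s10.
      have ->: [seq size (s1 x) | x <- vs] = rho by apply/eq_in_map => x /s1vs->.
      by rewrite s1d1 cats0.
    * by apply/negP=> /vsd; lia.
    * by move=> x /vsd; lia.
    * by move=> j le_j; rewrite /s1 upd_other ?empt //; lia.
    * by rewrite s10.
    * by move=> x xvs; rewrite s1vs ?vsm.
  have s2d : s2 d = v1 by rewrite /s2 /s1 upd_other ?upd_same //; lia.
  have s2d1 : s2 d.+1 = v2 by rewrite /s2 upd_same.
  apply: (exec_eqr _ (exec_mono _ (exec_compare _ _ _ _ _ _ _))); try lia.
  + by move=> j; rewrite s2d s2d1 /s2 /s1; case_regs; congruence.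
  + by rewrite s2d s2d1.
- set rho := [seq size (s x) | x <- vs]; set v1 := eval _ rho l1.
  have rhom : {in rho, forall i, i <= m} by move=> _ /mapP[x /vsm xm ->].
  have le1 : size v1 <= cost l1 m by apply: size_eval.
  have sd : s d = [::] by apply: empt; lia.
  have sd1 : s d.+1 = [::] by apply: empt; lia.
  pose s1 := upd s d v1.
  have s10 : s1 0 = s 0 by rewrite /s1 upd_other //; lia.
  have s1d : s1 d = v1 by rewrite /s1 upd_same.
  apply: (@exec_mono _ _ _ _
    (cost l1 m + (size v1 * 3 + size (s 0) * 14 + 6) + 1)); first lia.
  apply: (exec_seq (s1 := s1)).
    apply: (exec_eqr _ (IH1 _ _ _ m _ _ _ _ _ _ _ _ _ _)) => //; try lia.
    * by move=> j; rewrite sd cats0.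
    * by apply/negP=> /vsd; lia.
    * by move=> x /vsd; lia.
    * by move=> j le_j; apply: empt; lia.
  apply: (exec_eqr _ (exec_mono _ (exec_lookup _ _ _ _ _ _ _ _))); try lia.
  + by move=> j; rewrite s1d s10 /s1; case_regs; congruence.
  + by rewrite s1d s10.
  + by rewrite /s1 upd_other //; lia.
Qed.

End LoopExpressions.

(** The base is at least 2, so a larger exponent absorbs constants as well as the factor 2 that a
    sum produces. *)
Definition poly_bounded (f : nat -> nat) : Prop :=
  exists c, forall m, f m <= m.+2 ^ c.

Lemma poly_bounded_const a : poly_bounded (fun=> a).
Proof.
exists a => m; apply: leq_trans (ltnW (ltn_expl a (ltnSn 1))) _.
by case: a => // a; rewrite leq_exp2r.
Qed.

Lemma poly_bounded_id : poly_bounded id.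
Proof. by exists 1 => m; rewrite expn1; lia. Qed.

Lemma poly_bounded_mul f g :
  poly_bounded f -> poly_bounded g -> poly_bounded (fun m => f m * g m).
Proof.
by move=> [c fc] [d gd]; exists (c + d) => m; rewrite expnD leq_mul.
Qed.

Lemma poly_bounded_add f g :
  poly_bounded f -> poly_bounded g -> poly_bounded (fun m => f m + g m).
Proof.
move=> [c fc] [d gd]; exists (maxn c d).+1 => m.
have lef : m.+2 ^ c <= m.+2 ^ maxn c d by rewrite leq_exp2l // leq_maxl.
have leg : m.+2 ^ d <= m.+2 ^ maxn c d by rewrite leq_exp2l // leq_maxr.
by rewrite expnS; move: (fc m) (gd m) (m.+2 ^ maxn c d) lef leg; nia.
Qed.

Lemma poly_bounded_comp f g :
  poly_bounded f -> poly_bounded g -> poly_bounded (fun m => f (g m)).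
Proof.
(* The bound on [f] has base [g m + 2], so it is this sum that must be bounded by a power. *)
move=> [c fc] /poly_bounded_add /(_ (poly_bounded_const 2))[d gd].
exists (d * c) => m; apply: leq_trans (fc _) _.
by rewrite expnM; case: c {fc} => // c; rewrite leq_exp2r // -addn2.
Qed.

Lemma poly_bounded_cost (S : finType) (l : lexp S) : poly_bounded (cost l).
Proof.
elim: l => [|a|l1 IH1 l2 IH2||k|l1 IH1 l2 IH2|l1 IH1 l2 IH2|l1 IH1] /=;
  repeat (first [assumption | exact: poly_bounded_id
    | exact: poly_bounded_const | match goal with
      | |- poly_bounded (fun m => @?f m + @?g m) => apply: (@poly_bounded_add f g)
      | |- poly_bounded (fun m => @?f m * @?g m) => apply: (@poly_bounded_mul f g)
      | |- poly_bounded (fun m => ?f (@?g m)) => apply: (@poly_bounded_comp f g)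
      end]).
Qed.

Theorem polytime_eval (S : finType) (u : S) (l : lexp S) :
  polytime (fun w => eval u w [::] l).
Proof.
have [c cost_le] := poly_bounded_cost l.
(* Tape 0 is the input, tapes 1 to [depth l] are scratch, and [K] is the last tape, where the output
   is expected. *)
pose K := (depth l).+1; pose M := compile u K [::] 1 K l.
(* For n > 0, n + 2 <= 3n gives the first term of the bound; for n = 0 the additive constant covers
   2 ^ c. *)
exists (tm_of M), (3 ^ c), c => w.
pose s i := if i == 0 then w else [::].
have ex : exec M s (cost l (size w)) (upd s K (eval u w [::] l ++ s K)).
  by apply: compileP; rewrite // /K ?leqnn ?orbT // => -[|i].
have init_s : stacks (init (tm_of M) w).2 s.
  move=> i; rewrite ffunE /s -(inj_eq val_inj) /=.
  case: ifP => _; last by exists 1.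
  by case: w {s ex} => [|a w]; [exists 1 | exists 0; rewrite /= cats0].
have [ts [t [le_t [q [run halt]] out]]] := ex _ init_s.
exists t.
  apply: leq_trans le_t (leq_trans (cost_le _) _).
  case: (size w) => [|n]; last first.
    rewrite -expnMn; apply: leq_trans (leq_addr _ _).
    by case: c {cost_le} => // c; rewrite leq_exp2r //; lia.
  apply: leq_trans (leq_addl _ _).
  by case: c {cost_le} => // c; rewrite leq_exp2r.
exists (q, ts); split=> //.
by have := out ord_max; rewrite /= upd_same cats0.
Qed.

(** * The code of a graph *)

Section GraphCode.
Variables (F : fieldType) (n : nat).
Implicit Types (e : rel 'I_n) (p q : 'I_n * 'I_n).

(* The generator matrix is [I | I | I | I | diag e | D], one row for each pair
   of vertices, where D has ones in the columns of the two members of the pair. *)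
Definition gcoord : finType :=
  ('I_4 * ('I_n * 'I_n) + 'I_n * 'I_n + 'I_n)%type.

Implicit Types t : gcoord.

Definition entry e p t : bool :=
  match t with
  | inl (inl bq) => bq.2 == p
  | inl (inr q) => (q == p) && e p.1 p.2
  | inr k => (k == p.1) || (k == p.2)
  end.

Definition gen e p : 'rV[F]_#|gcoord| := \row_j (entry e p (enum_val j))%:R%R.

Definition gens e : #|{: 'I_n * 'I_n}|.-tuple 'rV[F]_#|gcoord| :=
  [tuple gen e (enum_val i) | i < #|{: 'I_n * 'I_n}|].

Definition graph_code e : {vspace 'rV[F]_#|gcoord|} := <<gens e>>%VS.

Lemma mem_gens e p : gen e p \in gens e.
Proof. by apply/tnthP; exists (enum_rank p); rewrite tnth_mktuple enum_rankK. Qed.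

Lemma gensP e v : v \in gens e -> exists p, v = gen e p.
Proof. by case/tnthP=> i ->; exists (enum_val i); rewrite tnth_mktuple. Qed.

Lemma genE e p t : gen e p 0%R (enum_rank t) = (entry e p t)%:R%R.
Proof. by rewrite mxE enum_rankK. Qed.

Lemma sum_gensE e (a : 'I_#|{: 'I_n * 'I_n}| -> F) :
  (\sum_i a i *: (gens e)`_i = \sum_p a (enum_rank p) *: gen e p)%R.
Proof.
rewrite [RHS](reindex _ (onW_bij _ (enum_val_bij _))).
by apply: eq_bigr => i _; rewrite enum_valK -tnth_nth tnth_mktuple.
Qed.

(** Each identity block displays the coefficients of a combination; this yields both the freeness of
    the rows and the lower bound on weights. *)
Lemma sum_gen_copy e (a : 'I_n * 'I_n -> F) b q :
  ((\sum_p a p *: gen e p) 0 (enum_rank (inl (inl (b, q)))) = a q)%R.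
Proof.
rewrite summxE (bigD1 q) //= mxE genE /= eqxx mulr1 big1 ?addr0 // => p pq.
by rewrite mxE genE /= eq_sym (negPf pq) mulr0.
Qed.

Lemma basis_gens e : basis_of (graph_code e) (gens e).
Proof.
rewrite /basis_of eqxx; apply/freeP => a; rewrite sum_gensE => a0 i.
have := sum_gen_copy e (fun p => a (enum_rank p)) ord0 (enum_val i).
by rewrite a0 mxE enum_valK.
Qed.

Lemma graph_codeP e v : v \in graph_code e ->
  exists a : 'I_n * 'I_n -> F, v = (\sum_p a p *: gen e p)%R.
Proof.
move=> /coord_span ->; rewrite sum_gensE.
by exists (fun p => coord (gens e) (enum_rank p) v).
Qed.

Definition wt m (v : 'rV[F]_m) : nat := #|[set j | v 0%R j != 0%R]|.

Lemma wt_col_perm m (s : 'S_m) (v : 'rV[F]_m) : wt (col_perm s v) = wt v.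
Proof.
rewrite /wt -(card_imset _ (@perm_inj _ s)); apply: eq_card => j.
rewrite -[j in LHS](permKV s) mem_imset; last exact: perm_inj.
by rewrite !inE mxE permKV.
Qed.

Lemma wt_sum_gen e (a : 'I_n * 'I_n -> F) :
  4 * #|[set p | a p != 0%R]| <= wt (\sum_p a p *: gen e p)%R.
Proof.
pose h (bp : 'I_4 * ('I_n * 'I_n)) : 'I_#|gcoord| := enum_rank (inl (inl bp)).
have h_inj : injective h by move=> x y /enum_rank_inj[].
rewrite -[4]card_ord -[#|'I_4|]cardsT -cardsX -(card_imset _ h_inj).
apply/subset_leq_card/subsetP=> _ /imsetP[[b q] + ->].
by rewrite in_setX !inE sum_gen_copy.
Qed.

Definition row_weight e p : nat := \sum_(t : gcoord) entry e p t.

(** For two distinct vertices the weight is 6 or 7 and so reveals the edge bit. *)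
Lemma row_weightE e p : row_weight e p = 4 + e p.1 p.2 + (p.1 != p.2).+1.
Proof.
rewrite /row_weight big_sumType big_sumType /=; congr (_ + _ + _).
- rewrite -(pair_bigA _ (fun b q => nat_of_bool (q == p))) /=.
  rewrite (eq_bigr (fun=> 1)) ?sum_nat_const ?card_ord // => b _.
  by rewrite (bigD1 p) //= eqxx big1 // => q /negPf->.
- by rewrite (bigD1 p) //= eqxx big1 ?addn0 // => q /negPf->.
- rewrite (bigD1 p.1) //= eqxx; congr _.+1; case: eqVneq => [<-|neq].
    by rewrite big1 // => k /negPf->.
  rewrite (bigD1 p.2) 1?eq_sym //= eqxx orbT big1 // => k /andP[/negPf-> /negPf->].
  by [].
Qed.

Lemma wt_gen e p : wt (gen e p) = row_weight e p.
Proof.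
rewrite /wt /row_weight -sum1_card big_mkcond /=.
rewrite [RHS](reindex _ (onW_bij _ (enum_val_bij _))) /=.
apply: eq_bigr => j _; rewrite inE mxE.
by case: entry; rewrite ?oner_neq0 ?eqxx.
Qed.

Lemma linfun_col_perm m (s : 'S_m) (v : 'rV[F]_m) :
  linfun (col_perm s : 'rV[F]_m -> 'rV[F]_m) v = col_perm s v.
Proof. by rewrite (lfunE (GRing.Linear.clone _ _ _ _ (col_perm s) _)). Qed.

(* A combination of two rows has weight at least 8, a row at most 7. *)
Lemma col_perm_gen (s : 'S_#|gcoord|) e1 e2 p :
    col_perm s (gen e1 p) \in graph_code e2 ->
  exists q, col_perm s (gen e1 p) = gen e2 q.
Proof.
move=> /graph_codeP[a def_v].
have le1 : #|[set q | a q != 0%R]| <= 1.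
  have := wt_sum_gen e2 a; rewrite -def_v wt_col_perm wt_gen row_weightE.
  by case: (e1 _ _); case: (p.1 != p.2); lia.
have [q aq] : exists q, a q != 0%R.
  apply/existsP; apply: contraT; rewrite negb_exists => /forallP a0.
  suff /eqP : wt (gen e1 p) = 0 by rewrite wt_gen row_weightE.
  rewrite -(wt_col_perm s) def_v big1 => [|q _].
    by apply: eq_card0 => j; rewrite !inE mxE eqxx.
  by move: (a0 q); rewrite negbK => /eqP->; rewrite scale0r.
have {}def_v : col_perm s (gen e1 p) = (a q *: gen e2 q)%R.
  rewrite def_v (bigD1 q) //= big1 ?addr0 // => q' neq.
  have [->|aq'] := eqVneq (a q') 0%R; first by rewrite scale0r.
  have := card_le1_eqP le1 q q'; rewrite !inE => /(_ aq aq') eqq.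
  by rewrite eqq eqxx in neq.
(* At an identity column of [q] the right side is [a q], nonzero, and the left side is an entry 0 or
   1. *)
exists q; suff aq1 : a q = 1%R by rewrite def_v aq1 scale1r.
have /matrixP/(_ 0%R (enum_rank (inl (inl (ord0, q))))) := def_v.
rewrite [in RHS]mxE genE /= eqxx mulr1 !mxE => def_aq.
by move: aq; rewrite -def_aq; case: entry; rewrite ?eqxx.
Qed.

Lemma entry_perm_iso e1 e2 (f : gcoord -> gcoord)
    (h : 'I_n * 'I_n -> 'I_n * 'I_n) :
    simple_graph e1 -> simple_graph e2 -> injective f ->
    (forall p t, entry e2 (h p) t = entry e1 p (f t)) ->
  graph_iso e1 e2.
Proof.
move=> [sym1 irr1] [sym2 irr2] f_inj eq_entry.
have [f' f'K fK'] := injF_bij f_inj.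
(* The column that [f] sends to an identity column of [p] has its only one among the rows [h p'] at
   those with [p' = p]. *)
have h_inj : injective h.
  move=> p p' eqh; apply/eqP.
  have := eq_entry p' (f' (inl (inl (ord0, p)))); rewrite -eqh eq_entry !fK' /=.
  by rewrite eqxx => <-.
have [h' h'K hK'] := injF_bij h_inj.
(* With at most one vertex no column of D is shared by two rows, but simple graphs of this size have
   no edges. *)
have [n1|n1] := leqP n 1.
  exists id; first exact: injF_bij.
  move=> x y; have -> : y = x by apply: ord_inj; move: (ltn_ord x) (ltn_ord y); lia.
  by rewrite irr1 irr2.
(* The vertex column of [k] has ones in the distinct rows [(k, k)] and [(k, k')], while a column of
   any other block has at most one. *)
have f_vertex k : exists k', f (inr k) = inr k'.
  have [k' k'k] : exists k' : 'I_n, k' != k.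
    have n0 : 0 < n by lia.
    have [eqk|neqk] := eqVneq (Ordinal n0) k; last by exists (Ordinal n0).
    by exists (Ordinal n1); rewrite -eqk.
  have := eq_entry (h' (k, k)) (inr k); have := eq_entry (h' (k, k')) (inr k).
  rewrite !hK' /= !eqxx /=.
  have neq : h' (k, k') <> h' (k, k).
    by move/(can_inj hK') => [eqk]; rewrite eqk eqxx in k'k.
  case: (f (inr k)) => [[[b q]|q]|k2]; last by exists k2.
    by move=> /esym/eqP q1 /esym/eqP q2; case: neq; rewrite -q1 -q2.
  by move=> /esym/andP[/eqP q1 _] /esym/andP[/eqP q2 _]; case: neq; rewrite -q1 -q2.
have [g gE] := fin_all_exists f_vertex.
have g_inj : injective g.
  by move=> k k' eqg; have [] : inr k = inr k' :> gcoord by apply: f_inj; rewrite !gE eqg.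
have weight_eq p : row_weight e2 (h p) = row_weight e1 p.
  rewrite /row_weight [RHS](reindex_inj f_inj).
  by apply: eq_bigr => t _; rewrite eq_entry.
(* The row matched with [(x, y)] has ones in the distinct columns [g x] and [g y], so its pair
   consists of these two in some order; symmetry and the equality of weights finish. *)
have e1g x y : e1 (g x) (g y) = e2 x y.
  have [->|neq] := eqVneq x y; first by rewrite irr1 irr2.
  have := eq_entry (h' (x, y)) (inr x); have := eq_entry (h' (x, y)) (inr y).
  have := weight_eq (h' (x, y)); rewrite !row_weightE !hK' /= !gE /= !eqxx orbT neq.
  have gneq : g x != g y by rewrite (inj_eq g_inj).
  case: (h' (x, y)) => i j /=.
  move=> wE /esym/orP[]/eqP gy /esym/orP[]/eqP gx.
  - by rewrite gx gy eqxx in gneq.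
  - move: wE; rewrite -gx -gy [g y == g x]eq_sym gneq sym1.
    by case: (e1 _ _); case: (e2 _ _).
  - by move: wE; rewrite -gx -gy gneq; case: (e1 _ _); case: (e2 _ _).
  - by rewrite gx gy eqxx in gneq.
have [g' g'K gK'] := injF_bij g_inj.
exists g'; first by exists g.
by move=> x y; rewrite -e1g !gK'.
Qed.

Lemma graph_iso_entry e1 e2 : graph_iso e1 e2 ->
  exists (f : gcoord -> gcoord) (h : 'I_n * 'I_n -> 'I_n * 'I_n),
    [/\ injective f, bijective h &
     forall p t, entry e2 (h p) t = entry e1 p (f t)].
Proof.
move=> [g [g' gK g'K] ge].
pose h2 (g : 'I_n -> 'I_n) p := (g p.1, g p.2).
pose f (g : 'I_n -> 'I_n) t : gcoord := match t with
  | inl (inl bq) => inl (inl (bq.1, h2 g bq.2))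
  | inl (inr q) => inl (inr (h2 g q))
  | inr k => inr (g k)
  end.
have h2K : cancel (h2 g) (h2 g') by move=> [i j]; rewrite /h2 /= !gK.
have h2K' : cancel (h2 g') (h2 g) by move=> [i j]; rewrite /h2 /= !g'K.
(* Rows are pushed forward along [g], columns are pulled back along its inverse. *)
exists (f g'), (h2 g); split.
- by apply: (@can_inj _ _ _ (f g)) => -[[[b q]|q]|k]; rewrite /f ?h2K' ?g'K.
- by exists (h2 g').
- move=> p [[[b q]|q]|k] /=.
  + by rewrite (can2_eq h2K' h2K).
  + by rewrite (can2_eq h2K' h2K) ge.
  + by rewrite !(can2_eq g'K gK).
Qed.

Lemma graph_code_equivP e1 e2 : simple_graph e1 -> simple_graph e2 ->
  graph_iso e1 e2 <-> code_equiv (graph_code e1) (graph_code e2).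
Proof.
move=> simple1 simple2; split.
- move=> /graph_iso_entry[f [h [f_inj [h' hK h'K] eq_entry]]].
  have s_inj : injective (fun j : 'I_#|gcoord| => enum_rank (f (enum_val j))).
    by move=> i j /enum_rank_inj/f_inj/enum_val_inj.
  exists (perm s_inj); rewrite /perm_code limg_span; apply: eq_span => v.
  have perm_gen p : linfun (col_perm (perm s_inj) : 'rV[F]_#|gcoord| -> _)
      (gen e1 p) = gen e2 (h p).
    rewrite linfun_col_perm; apply/rowP=> j.
    by rewrite !mxE permE enum_rankK eq_entry.
  apply/mapP/idP => [[w /gensP[p ->] ->]|/gensP[q ->]].
    by rewrite perm_gen mem_gens.
  by exists (gen e1 (h' q)); rewrite ?mem_gens // perm_gen h'K.
- move=> [s eq_code].
  (* [col_perm s] puts coordinate [s j] in place [j], so [f] leads from columns of the second matrix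
     to columns of the first. *)
  pose f t := enum_val (s (enum_rank t)).
  have f_inj : injective f.
    by move=> t t' /enum_val_inj/perm_inj/enum_rank_inj.
  have row_to p : exists q, forall t, entry e2 q t = entry e1 p (f t).
    have [|q eq_q] := @col_perm_gen s e1 e2 p.
      rewrite -eq_code -linfun_col_perm; apply: memv_img.
      by apply: memv_span; apply: mem_gens.
    exists q => t; have /matrixP/(_ 0%R (enum_rank t)) := eq_q.
    rewrite genE !mxE -/(f t).
    by do 2!case: entry => //; move=> /eqP; rewrite ?oner_eq0 // eq_sym oner_eq0.
  have [h eq_entry] := fin_all_exists row_to.
  exact: entry_perm_iso eq_entry.
Qed.

End GraphCode.

(** * The reduction *)

(** The encoding of a basis follows the enumeration of finite types; nested loops can write it
    because pairs are enumerated lexicographically. *)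
Lemma enum_prodE (T1 T2 : finType) :
  enum {: T1 * T2} = [seq (x, y) | x <- enum T1, y <- enum T2].
Proof. by rewrite [in LHS]enumT [in LHS]unlock. Qed.

Lemma enum_sumE (T1 T2 : finType) :
  enum {: T1 + T2} = map inl (enum T1) ++ map inr (enum T2).
Proof. by rewrite !enumT [in LHS]unlock. Qed.

Lemma map_enum_val (T : finType) :
  [seq enum_val i | i <- enum 'I_#|T|] = enum T.
Proof.
case: (pickP T) => [x0 _|T0]; last first.
  have T0' : #|T| = 0 by apply: eq_card0.
  rewrite (eqP (_ : enum T == [::])) -?size_eq0 -?cardE ?T0' //.
  by apply/nilP; rewrite /nilp size_map size_enum_ord T0'.
apply: (@eq_from_nth _ x0) => [|i]; rewrite size_map size_enum_ord -?cardE //.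
move=> lti; rewrite (nth_map (Ordinal lti)) ?size_enum_ord //.
by rewrite (enum_val_nth x0) nth_enum_ord.
Qed.

Lemma flatten_map_allpairs (T1 T2 : Type) (R : Type) (g : T1 -> T2 -> seq R) s t :
  flatten [seq g x y | x <- s, y <- t] =
  flatten [seq flatten [seq g x y | y <- t] | x <- s].
Proof. by elim: s => //= x s IH; rewrite flatten_cat IH. Qed.

Lemma map_ord_enum (R : Type) (n : nat) (g : nat -> R) :
  [seq g (val i) | i <- enum 'I_n] = [seq g i | i <- iota 0 n].
Proof. by rewrite -val_enum_ord -map_comp. Qed.

Lemma flatten_enum_sum (T1 T2 : finType) (R : Type) (g : T1 + T2 -> seq R) :
  flatten [seq g x | x <- enum {: T1 + T2}] =
  flatten [seq g (inl x) | x <- enum T1] ++ flatten [seq g (inr y) | y <- enum T2].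
Proof. by rewrite enum_sumE map_cat flatten_cat -!(map_comp g). Qed.

Lemma flatten_enum_prod (T1 T2 : finType) (R : Type) (g : T1 * T2 -> seq R) :
  flatten [seq g p | p <- enum {: T1 * T2}] =
  flatten [seq flatten [seq g (x, y) | y <- enum T2] | x <- enum T1].
Proof. by rewrite enum_prodE map_allpairs flatten_map_allpairs. Qed.

(** * Unique decoding of encoded bases *)

Lemma enc_nat_inj n1 n2 v1 v2 :
  enc_nat n1 ++ v1 = enc_nat n2 ++ v2 -> n1 = n2 /\ v1 = v2.
Proof.
elim: n1 n2 => [|n1 IH] [|n2] //=; first by case.
by case=> /IH[-> ->].
Qed.

Lemma enc_bits_inj s1 s2 v1 v2 :
  enc_bits s1 ++ v1 = enc_bits s2 ++ v2 -> s1 = s2 /\ v1 = v2.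
Proof.
elim: s1 s2 => [|b1 s1 IH] [|b2 s2] //=; first by case.
by case=> -> /IH[-> ->].
Qed.

Lemma enc_bitss_inj (ss1 ss2 : seq (seq bool)) v1 v2 : size ss1 = size ss2 ->
  flatten (map enc_bits ss1) ++ v1 = flatten (map enc_bits ss2) ++ v2 ->
  ss1 = ss2 /\ v1 = v2.
Proof.
elim: ss1 ss2 => [|s1 ss1 IH] [|s2 ss2] //= [eq_sz].
by rewrite -!catA => /enc_bits_inj[-> /IH[] // -> ->].
Qed.

Section Decoding.
Variables (F : fieldType) (rep : seq bool -> option F).

(** All components are self-delimiting, so a word fixes the names of the entries, and [rep] fixes
    the entries themselves, even if elements have several names. *)
Lemma encodes_basis_inj n k1 k2 (B1 : k1.-tuple 'rV[F]_n) (B2 : k2.-tuple 'rV[F]_n)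
    u1 u2 v1 v2 :
    encodes_basis rep B1 u1 -> encodes_basis rep B2 u2 ->
    u1 ++ v1 = u2 ++ v2 ->
  B1 = B2 :> seq _ /\ v1 = v2.
Proof.
move=> [W1 rep1 ->] [W2 rep2 ->]; rewrite -!catA => /enc_nat_inj[eqk].
move: B2 W2 rep2; rewrite -{}eqk => B2 W2 rep2.
rewrite -!(map_allpairs enc_bits) => /enc_bitss_inj[|eqW ->].
  by rewrite !size_allpairs.
split=> //; congr tval; apply/eq_from_tnth => i; apply/rowP => j.
apply: Some_inj; rewrite -rep1 -rep2; congr rep.
have pairE (W : 'I_k1 -> 'I_n -> seq bool) : [seq W i j | i <- enum 'I_k1, j <- enum 'I_n]
    = [seq W p.1 p.2 | p <- [seq (i, j) | i <- enum 'I_k1, j <- enum 'I_n]].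
  by rewrite map_allpairs.
move: eqW; rewrite !pairE => /eq_in_map/(_ (i, j)); apply.
by apply/allpairsP; exists (i, j); rewrite !mem_enum.
Qed.

End Decoding.

(** * The reduction as a loop expression, and its value *)

Section Reduction.
Variables w0 w1 : seq bool.

Notation tick := (Some true : sym).
Notation ev := (eval tick).
Notation expr := (lexp sym).

Definition word_expr (v : seq sym) : expr :=
  foldr (fun a l => Cat (Single a) l) (Empty _) v.
(** Truth values are the words [nseq b tick]. Conjunction asks for two ticks in a row; the double
    negation in [or_expr] shrinks up to two ticks to one. [For] over a truth value is a guard. *)
Definition not_expr (l : expr) : expr := Same l (Empty _).
Definition and_expr (l1 l2 : expr) : expr :=
  Same (Cat l1 l2) (word_expr [:: tick; tick]).
Definition or_expr (l1 l2 : expr) : expr := not_expr (not_expr (Cat l1 l2)).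
Definition if_expr (l : expr) (v1 v2 : seq sym) : expr :=
  Cat (For l (word_expr v1)) (For (not_expr l) (word_expr v2)).
Definition eq_expr (i j : nat) : expr := Same (Tick _ i) (Tick _ j).
Definition square_expr (n : nat) : expr := For (Tick _ n) (Tick _ n.+1).

(* The vertex count n and the vertices i, j are given by their variable
   indices; off maps n to the position of the first entry of the matrix. *)
Definition bit_expr (off : nat -> expr) (n i j : nat) : expr :=
  Same (Letter (Cat (off n) (Cat (For (Tick _ i) (Tick _ n.+1)) (Tick _ j))))
       (Single tick).

Definition edge_expr off n i j : expr :=
  and_expr (and_expr (bit_expr off n i j) (bit_expr off n j i))
           (not_expr (eq_expr i j)).

(** As an offset only its length n + 1 counts, but its value is the header [enc_nat n] itself, which
    [graph_expr] reuses. *)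
Definition off1_expr (n : nat) : expr := Cat (Tick _ n) (Single None).
Definition off2_expr (n : nat) : expr :=
  Cat (off1_expr n) (Cat (square_expr n) (off1_expr n)).

Definition graph_expr off n : expr :=
  Cat (off1_expr n)
    (For (Tick _ n) (For (Tick _ n.+1)
      (if_expr (edge_expr off n.+2 1 0) [:: Some true] [:: Some false]))).

Definition entry_expr (l : expr) : expr := if_expr l (enc_bits w1) (enc_bits w0).

Definition row_expr off n i j : expr :=
  Cat (Cat
   (For (word_expr (nseq 4 tick)) (For (Tick _ n.+1) (For (Tick _ n.+2)
     (entry_expr (and_expr (eq_expr 1 i.+3) (eq_expr 0 j.+3))))))
   (For (Tick _ n) (For (Tick _ n.+1)
     (entry_expr (and_expr (and_expr (eq_expr 1 i.+2) (eq_expr 0 j.+2))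
                           (edge_expr off n.+2 i.+2 j.+2))))))
   (For (Tick _ n) (entry_expr (or_expr (eq_expr 0 i.+1) (eq_expr 0 j.+1)))).

Definition code_expr off n : expr :=
  Cat (Cat (square_expr n) (Single None))
      (For (Tick _ n) (For (Tick _ n.+1) (row_expr off n.+2 1 0))).

Definition length_expr n : expr :=
  Cat (Cat (Cat (For (word_expr (nseq 4 tick)) (square_expr n.+1)) (square_expr n))
           (Tick _ n)) (Single None).

(** The outer loop guesses the vertex count and the inner one is the guard that re-encodes. The
    guard binds a variable of its own, so the count has index 0 in the test but 1 in the body. *)
Definition reduction_expr : expr :=
  For (Input _) (For (Same (Input _) (Cat (graph_expr off1_expr 0)
                                         (graph_expr off2_expr 0)))
    (Cat (length_expr 1) (Cat (code_expr off1_expr 1) (code_expr off2_expr 1)))).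

Lemma eval_word w rho v : ev w rho (word_expr v) = v.
Proof. by elim: v => //= a v ->. Qed.

Lemma eval_cat w rho l1 l2 : ev w rho (Cat l1 l2) = ev w rho l1 ++ ev w rho l2.
Proof. by []. Qed.

Lemma eval_for w rho l1 l2 : ev w rho (For l1 l2) =
  flatten [seq ev w (i :: rho) l2 | i <- iota 0 (size (ev w rho l1))].
Proof. by []. Qed.

Lemma size_eval_tick w rho k n :
  nth (size w) rho k = n -> size (ev w rho (Tick _ k)) = n.
Proof. by move=> /= ->; rewrite size_nseq. Qed.

Lemma eval_same w rho l1 l2 :
  ev w rho (Same l1 l2) = nseq (ev w rho l1 == ev w rho l2) tick.
Proof. by []. Qed.

Lemma eval_guard w rho l1 l2 (b : bool) : ev w rho l1 = nseq b tick ->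
  ev w rho (For l1 l2) = if b then ev w (0 :: rho) l2 else [::].
Proof. by move=> def_b; rewrite eval_for def_b; case: b {def_b}; rewrite //= cats0. Qed.

Lemma eval_not w rho l (b : bool) :
  ev w rho l = nseq b tick -> ev w rho (not_expr l) = nseq (~~ b) tick.
Proof. by move=> /= ->; case: b. Qed.

Lemma eval_and w rho l1 l2 (b1 b2 : bool) :
    ev w rho l1 = nseq b1 tick -> ev w rho l2 = nseq b2 tick ->
  ev w rho (and_expr l1 l2) = nseq (b1 && b2) tick.
Proof. by move=> /= -> ->; case: b1; case: b2. Qed.

Lemma eval_or w rho l1 l2 (b1 b2 : bool) :
    ev w rho l1 = nseq b1 tick -> ev w rho l2 = nseq b2 tick ->
  ev w rho (or_expr l1 l2) = nseq (b1 || b2) tick.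
Proof. by move=> /= -> ->; case: b1; case: b2. Qed.

Lemma eval_if w rho l v1 v2 (b : bool) :
    ev w rho l = nseq b tick ->
  ev w rho (if_expr l v1 v2) = if b then v1 else v2.
Proof.
by move=> /= ->; rewrite !size_nseq; case: b; rewrite /= ?eval_word ?cats0.
Qed.

Lemma eqseq_nseq (a : sym) m n : (nseq m a == nseq n a) = (m == n).
Proof.
apply/eqP/eqP => [|-> //].
by move/(congr1 size); rewrite !size_nseq.
Qed.

Lemma eval_eq w rho i j m n :
    nth (size w) rho i = m -> nth (size w) rho j = n ->
  ev w rho (eq_expr i j) = nseq (m == n) tick.
Proof. by move=> /= -> ->; rewrite eqseq_nseq. Qed.

Lemma flatten_nseq (a : sym) m (s : seq nat) :
  flatten [seq nseq m a | _ <- s] = nseq (size s * m) a.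
Proof. by elim: s => //= _ s ->; rewrite -nseqD. Qed.

Lemma eval_square w rho k n :
  nth (size w) rho k = n -> ev w rho (square_expr k) = nseq (n * n) tick.
Proof. by move=> /= ->; rewrite flatten_nseq size_iota size_nseq. Qed.

Definition letter_bit (w : seq sym) (k : nat) : bool :=
  take 1 (drop k w) == [:: tick].

(* Symmetrizing and dropping loops makes this a simple graph for every w. *)
Definition edge_of (w : seq sym) (o n i j : nat) : bool :=
  [&& letter_bit w (o + (i * n + j)), letter_bit w (o + (j * n + i)) & i != j].

Definition graph_of (w : seq sym) (o n : nat) : rel 'I_n := fun i j => edge_of w o n i j.

Lemma graph_of_simple w o n : simple_graph (graph_of w o (n := n)).
Proof.
split=> [i j|i]; rewrite /graph_of /edge_of; last by rewrite eqxx !andbF.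
by rewrite [val i == val j]eq_sym andbCA.
Qed.

Definition off1 (n : nat) : nat := n + 1.
Definition off2 (n : nat) : nat := off1 n + (n * n + off1 n).

Definition evaluates_to (off : nat -> expr) (o : nat -> nat) :=
  forall w rho k, size (ev w rho (off k)) = o (nth (size w) rho k).

Lemma size_eval_off1 : evaluates_to off1_expr off1.
Proof. by move=> w rho k; rewrite /= size_cat size_nseq. Qed.

Lemma size_eval_off2 : evaluates_to off2_expr off2.
Proof.
move=> w rho k; rewrite eval_cat size_cat size_eval_off1.
by rewrite eval_cat size_cat size_eval_off1 (eval_square erefl) size_nseq.
Qed.

Lemma eval_edge off o w rho kn ki kj n i j : evaluates_to off o ->
    nth (size w) rho kn = n -> nth (size w) rho ki = i ->
    nth (size w) rho kj = j ->
  ev w rho (edge_expr off kn ki kj) = nseq (edge_of w (o n) n i j) tick.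
Proof.
move=> size_off <- <- <-; rewrite /edge_of andbA.
have eval_bit k1 k2 : ev w rho (bit_expr off kn k1 k2) =
    nseq (letter_bit w (o (nth (size w) rho kn) +
      (nth (size w) rho k1 * nth (size w) rho kn + nth (size w) rho k2))) tick.
  by rewrite /= !size_cat size_off flatten_nseq size_iota !size_nseq.
by apply: eval_and; [apply: eval_and | apply/eval_not/eval_eq].
Qed.

Lemma enc_graphE n (e : nat -> nat -> bool) :
  enc_graph (fun i j : 'I_n => e i j) = enc_nat n ++
    flatten [seq flatten [seq [:: Some (e i j)] | j <- iota 0 n] | i <- iota 0 n].
Proof.
congr (_ ++ flatten _).
rewrite -(map_ord_enum _ (fun i => flatten [seq [:: Some (e i j)] | j <- iota 0 n])).
apply: eq_map => i; rewrite -(map_ord_enum _ (fun j => [:: Some (e i j)])).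
by elim: (enum _) => //= j s ->.
Qed.

Lemma eval_graph off o w rho k n : evaluates_to off o ->
    nth (size w) rho k = n ->
  ev w rho (graph_expr off k) = enc_graph (graph_of w (o n) (n := n)).
Proof.
move=> size_off kn; rewrite enc_graphE eval_cat eval_for (size_eval_tick kn).
congr (_ ++ flatten _); first by rewrite /= kn cats1.
apply: eq_map => i; rewrite eval_for (size_eval_tick (n := n)) //; congr flatten.
apply: eq_map => j; rewrite (eval_if _ _
  (eval_edge (rho := j :: i :: rho) (kn := k.+2) size_off kn erefl erefl)) /=.
by case: edge_of.
Qed.

Definition entry_word (b : bool) : seq sym := enc_bits (if b then w1 else w0).

Lemma eval_entry w rho l (b : bool) :
  ev w rho l = nseq b tick -> ev w rho (entry_expr l) = entry_word b.
Proof. by move=> /eval_if->; rewrite /entry_word; case: b. Qed.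

Definition gens_word n (e : rel 'I_n) : seq sym :=
  enc_nat #|{: 'I_n * 'I_n}| ++
  flatten [seq entry_word (entry e p t) |
    p <- enum {: 'I_n * 'I_n}, t <- enum (gcoord n)].

Definition row_word n (e : nat -> nat -> bool) (i j : nat) : seq sym :=
  (flatten [seq flatten [seq flatten [seq
      entry_word ((i' == i) && (j' == j))
    | j' <- iota 0 n] | i' <- iota 0 n] | _ <- iota 0 4] ++
  flatten [seq flatten [seq
      entry_word ((i' == i) && (j' == j) && e i j)
    | j' <- iota 0 n] | i' <- iota 0 n]) ++
  flatten [seq entry_word ((k == i) || (k == j)) | k <- iota 0 n].

Lemma flatten_enum_pairs n (g : nat -> nat -> seq sym) :
  flatten [seq g (val p.1) (val p.2) | p <- enum {: 'I_n * 'I_n}] =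
  flatten [seq flatten [seq g i j | j <- iota 0 n] | i <- iota 0 n].
Proof.
rewrite flatten_enum_prod; congr flatten.
rewrite -(map_ord_enum _ (fun i => flatten [seq g i j | j <- iota 0 n])).
by apply: eq_map => i; rewrite -(map_ord_enum _ (g i)).
Qed.

Lemma row_wordE n (e : nat -> nat -> bool) (p : 'I_n * 'I_n) :
  flatten [seq entry_word (entry (fun i j : 'I_n => e i j) p t) | t <- enum (gcoord n)] =
  row_word n e (val p.1) (val p.2).
Proof.
rewrite !flatten_enum_sum; congr ((_ ++ _) ++ _).
- rewrite flatten_enum_prod; congr flatten.
  rewrite -(map_ord_enum _ (fun=> _)); apply: eq_map => b.
  by rewrite -flatten_enum_pairs.
- by rewrite -flatten_enum_pairs.
- by rewrite -map_ord_enum.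
Qed.

Lemma gens_wordE n (e : nat -> nat -> bool) :
  gens_word (fun i j : 'I_n => e i j) = enc_nat (n * n) ++
    flatten [seq flatten [seq row_word n e i j | j <- iota 0 n] | i <- iota 0 n].
Proof.
rewrite /gens_word card_prod card_ord; congr (_ ++ _).
rewrite flatten_map_allpairs -flatten_enum_pairs; congr flatten.
by apply: eq_map => p; rewrite row_wordE.
Qed.

Lemma size_eval_word w rho v : size (ev w rho (word_expr v)) = size v.
Proof. by rewrite eval_word. Qed.

Lemma eval_code off o w rho k n : evaluates_to off o ->
    nth (size w) rho k = n ->
  ev w rho (code_expr off k) = gens_word (graph_of w (o n) (n := n)).
Proof.
move=> size_off kn; rewrite gens_wordE eval_cat eval_cat (eval_square kn).
rewrite cats1; congr (_ ++ _).
rewrite eval_for (size_eval_tick kn); congr flatten; apply: eq_map => i.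
rewrite eval_for (size_eval_tick (n := n)) //; congr flatten; apply: eq_map => j.
rewrite eval_cat eval_cat; congr ((_ ++ _) ++ _).
- rewrite eval_for size_eval_word; congr flatten; apply: eq_map => b.
  rewrite eval_for (size_eval_tick (n := n)) //; congr flatten; apply: eq_map => i'.
  rewrite eval_for (size_eval_tick (n := n)) //; congr flatten; apply: eq_map => j'.
  by apply/eval_entry/eval_and; apply: eval_eq.
- rewrite eval_for (size_eval_tick (n := n)) //; congr flatten; apply: eq_map => i'.
  rewrite eval_for (size_eval_tick (n := n)) //; congr flatten; apply: eq_map => j'.
  apply/eval_entry/eval_and; first by apply: eval_and; apply: eval_eq.
  exact: (eval_edge size_off).
- rewrite eval_for (size_eval_tick (n := n)) //; congr flatten; apply: eq_map => i'.
  by apply/eval_entry/eval_or; apply: eval_eq.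
Qed.

Lemma eval_length w rho k n : nth (size w) rho k = n ->
  ev w rho (length_expr k) = enc_nat #|gcoord n|.
Proof.
move=> kn; rewrite !card_sum !card_prod !card_ord.
rewrite eval_cat [ev _ _ (Single _)]/= cats1; congr rcons.
rewrite 2!eval_cat 2!nseqD; congr ((_ ++ _) ++ _).
- rewrite eval_for size_eval_word -[RHS](flatten_nseq tick (n * n) (iota 0 4)).
  by congr flatten; apply: eq_map => b; apply: eval_square.
- exact: eval_square.
- by rewrite /= kn.
Qed.

Definition codes_word n (e1 e2 : rel 'I_n) : seq sym :=
  enc_nat #|gcoord n| ++ gens_word e1 ++ gens_word e2.

Lemma eval_reduction w : ev w [::] reduction_expr =
  flatten [seq codes_word (graph_of w (off1 n) (n := n)) (graph_of w (off2 n) (n := n))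
          | n <- iota 0 (size w) &
            w == enc_graph (graph_of w (off1 n) (n := n)) ++
                 enc_graph (graph_of w (off2 n) (n := n))].
Proof.
have flatten_filter (P : pred nat) (g : nat -> seq sym) s :
    flatten [seq g n | n <- s & P n] = flatten [seq (if P n then g n else [::]) | n <- s].
  by elim: s => //= n s <-; case: (P n).
rewrite flatten_filter eval_for; congr flatten; apply: eq_map => n.
rewrite (eval_guard _ (eval_same _ _ _ _)) eval_cat.
rewrite (eval_graph (n := n) size_eval_off1) // (eval_graph (n := n) size_eval_off2) //.
congr (if _ then _ else _); rewrite eval_cat (eval_length (n := n)) // eval_cat.
by rewrite (eval_code (n := n) size_eval_off1) // (eval_code (n := n) size_eval_off2).
Qed.

(** * Reading the graphs back from the input *)

Lemma letter_bit_cat (v1 v2 : seq sym) k :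
  letter_bit (v1 ++ v2) (size v1 + k) = letter_bit v2 k.
Proof. by rewrite /letter_bit addnC -drop_drop drop_size_cat. Qed.

Lemma letter_bit_matrix n (e : rel 'I_n) (v : seq sym) (i j : 'I_n) :
  letter_bit ([seq Some (e i j) | i <- enum 'I_n, j <- enum 'I_n] ++ v) (i * n + j)
  = e i j.
Proof.
have split_at (x : 'I_n) : enum 'I_n = take x (enum 'I_n) ++ x :: drop x.+1 (enum 'I_n).
  rewrite -[LHS](cat_take_drop x) (drop_nth x) ?size_enum_ord //.
  by rewrite nth_ord_enum.
have size_at (x : 'I_n) : size (take x (enum 'I_n)) = x.
  by rewrite size_takel // size_enum_ord ltnW.
pose f (x y : 'I_n) := Some (e x y) : sym.
have -> : [seq f x y | x <- enum 'I_n, y <- enum 'I_n] =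
    [seq f x y | x <- take i (enum 'I_n) ++ i :: drop i.+1 (enum 'I_n), y <- enum 'I_n].
  by rewrite -split_at.
rewrite allpairs_cat allpairs_cons -!catA.
have -> : i * n + j = size [seq f x y | x <- take i (enum 'I_n), y <- enum 'I_n] + j.
  by rewrite size_allpairs size_at size_enum_ord.
rewrite letter_bit_cat.
have -> : map (f i) (enum 'I_n) = map (f i) (take j (enum 'I_n) ++ j :: drop j.+1 (enum 'I_n)).
  by rewrite -split_at.
rewrite map_cat -catA.
have := letter_bit_cat (map (f i) (take j (enum 'I_n))) _ 0.
by rewrite size_map size_at addn0 => ->; rewrite /letter_bit /= /f take0; case: (e i j).
Qed.

Lemma graph_of_cat n (e : rel 'I_n) (v1 v2 w : seq sym) o :
    simple_graph e -> w = v1 ++ enc_graph e ++ v2 -> size v1 + n.+1 = o ->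
  graph_of w o (n := n) =2 e.
Proof.
move=> [sym_e irr_e] -> <- i j.
have bitE (x y : 'I_n) : letter_bit (v1 ++ enc_graph e ++ v2)
    (size v1 + n.+1 + (x * n + y)) = e x y.
  rewrite -addnA letter_bit_cat -catA.
  have sz : size (enc_nat n) = n.+1 by rewrite size_rcons size_nseq.
  by rewrite -{1}sz letter_bit_cat letter_bit_matrix.
rewrite /graph_of /edge_of !bitE sym_e andbA andbb.
case: (eqVneq i j) => [->|ij]; first by rewrite irr_e.
by rewrite (_ : _ != _) ?andbT.
Qed.

Lemma flatten_map1 (g : nat -> seq sym) k : flatten [seq g i | i <- [:: k]] = g k.
Proof. by rewrite /= cats0. Qed.

Lemma eval_reduction_graphs n (e1 e2 : rel 'I_n) :
    simple_graph e1 -> simple_graph e2 ->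
  ev (enc_graph e1 ++ enc_graph e2) [::] reduction_expr = codes_word e1 e2.
Proof.
move=> simple1 simple2; set w := _ ++ _.
have eq1 : graph_of w (off1 n) (n := n) =2 e1.
  by apply: (@graph_of_cat _ _ [::] (enc_graph e2)); rewrite // /off1 addn1.
have eq2 : graph_of w (off2 n) (n := n) =2 e2.
  apply: (@graph_of_cat _ _ (enc_graph e1) [::]); rewrite ?cats0 //.
  rewrite size_cat size_allpairs size_enum_ord size_rcons size_nseq.
  by rewrite /off2 /off1; lia.
have eq_enc (e e' : rel 'I_n) : e =2 e' -> enc_graph e = enc_graph e'.
  by move=> eq_e; congr (_ ++ _); apply: eq_allpairs => i j; rewrite eq_e.
have eq_gens (e e' : rel 'I_n) : e =2 e' -> gens_word e = gens_word e'.
  move=> eq_e; congr (_ ++ flatten _); apply: eq_allpairs => p t; congr entry_word.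
  by case: t => [[]|] //= q; rewrite eq_e.
(* The unary header determines the vertex count, so [n] alone passes the test; it is tried because
   it is less than the length of the input. *)
rewrite eval_reduction (eq_in_filter (a2 := pred1 n)).
  rewrite filter_pred1_uniq ?iota_uniq ?mem_iota //; last first.
    by rewrite !size_cat size_rcons size_nseq; lia.
  by rewrite flatten_map1 /codes_word (eq_gens _ _ eq1) (eq_gens _ _ eq2).
move=> m _ /=; apply/eqP/eqP => [|->]; last first.
  by rewrite (eq_enc _ _ eq1) (eq_enc _ _ eq2).
by rewrite /w /enc_graph -!catA => /enc_nat_inj[].
Qed.

Lemma eval_reduction_nil w : ev w [::] reduction_expr != [::] ->
  exists n (e1 e2 : rel 'I_n),
    [/\ simple_graph e1, simple_graph e2 & w = enc_graph e1 ++ enc_graph e2].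
Proof.
rewrite eval_reduction; case E: [seq _ <- _ | _] => [//|n s] _.
have : n \in n :: s by rewrite mem_head.
rewrite -E mem_filter => /andP[/eqP def_w _].
exists n, (graph_of w (off1 n) (n := n)), (graph_of w (off2 n) (n := n)).
by split=> //; apply: graph_of_simple.
Qed.

Variables (F : fieldType) (rep : seq bool -> option F).
Hypotheses (rep_w0 : rep w0 = Some 0%R) (rep_w1 : rep w1 = Some 1%R).

Lemma encodes_gens n (e : rel 'I_n) : encodes_basis rep (gens F e) (gens_word e).
Proof.
exists (fun i j => if entry e (enum_val i) (enum_val j) then w1 else w0).
  move=> i j; rewrite tnth_mktuple mxE.
  by case: entry; rewrite ?rep_w0 ?rep_w1.
congr (_ ++ flatten _).
rewrite -(map_enum_val ('I_n * 'I_n)%type) -(map_enum_val (gcoord n)).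
by rewrite allpairs_mapl allpairs_mapr.
Qed.

(** Membership only provides some codes and bases written by this word; unique decoding identifies
    them with the intended ones. *)
Lemma codes_wordP n (e1 e2 : rel 'I_n) :
  CodeEquiv rep (codes_word e1 e2) <->
  code_equiv (graph_code F e1) (graph_code F e2).
Proof.
split; last first.
  move=> equiv.
  exists #|gcoord n|, #|{: 'I_n * 'I_n}|, #|{: 'I_n * 'I_n}|.
  exists (graph_code F e1), (graph_code F e2), (gens F e1), (gens F e2).
  exists (gens_word e1), (gens_word e2).
  by split; rewrite //; split; rewrite ?basis_gens //; apply: encodes_gens.
move=> [m [k1 [k2 [C1 [C2 [B1 [B2 [u1 [u2 []]]]]]]]]].
move=> [basis1 enc1] [basis2 enc2] /enc_nat_inj[eqm eq_u].
move: C1 C2 B1 B2 basis1 basis2 enc1 enc2; rewrite -{}eqm.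
move=> C1 C2 B1 B2 basis1 basis2 enc1 enc2.
have [eqB1 eq_u2] := encodes_basis_inj (encodes_gens e1) enc1 eq_u.
have [|eqB2 _] := @encodes_basis_inj _ _ _ _ _ _ _ _ _ [::] [::] (encodes_gens e2) enc2.
  by rewrite !cats0.
rewrite -(span_basis basis1) -(span_basis basis2) -eqB1 -eqB2.
by [].
Qed.

End Reduction.

Local Open Scope ring_scope.

Theorem lemma2p4 (F : fieldType) (rep : seq bool -> option F)
    (rep0 : exists w : seq bool, rep w = Some 0)
    (rep1 : exists w : seq bool, rep w = Some 1) :
  karp_reduces GraphIso (CodeEquiv rep).
Proof.
have [w0 rep_w0] := rep0; have [w1 rep_w1] := rep1.
exists (fun w => eval (Some true : sym) w [::] (reduction_expr w0 w1)).
  exact: polytime_eval.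
move=> w; split.
- move=> [n1 [n2 [e1 [e2 [simple1 simple2 ->]]]]] iso.
  (* [GraphIso] admits different vertex counts, whereas the reduction tries a common one. *)
  have eqn : n1 = n2.
    by have [f /bij_eq_card] := iso; rewrite !card_ord.
  move: e2 simple2 iso; rewrite -{}eqn => e2 simple2 iso.
  rewrite eval_reduction_graphs //; apply/(codes_wordP rep_w0 rep_w1).
  exact/graph_code_equivP.
- move=> equiv.
  (* A member of [CodeEquiv] begins with a header, so the output is not empty and [w] is a genuine
     pair of encoded graphs. *)
  have [|n [e1 [e2 [simple1 simple2 def_w]]]] := @eval_reduction_nil w0 w1 w.
    case: equiv => m [k1 [k2 [C1 [C2 [B1 [B2 [u1 [u2 [_ _ -> _]]]]]]]]].
    by case: m {C1 C2 B1 B2}.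
  exists n, n, e1, e2; split=> //; apply/(graph_code_equivP F) => //.
  by apply/(codes_wordP rep_w0 rep_w1); rewrite -eval_reduction_graphs // -def_w.
Qed.
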